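(* Let $f\in\mathcal{A}_c(\mathbb{T})$ and let $\{k_n\}$ be a summability kernel. Then $\|f\ast k_n-f\|_{\mathbb{T}}\to0$ as $n\to\infty$.
   Context: ''Periodic'' means $2\pi$-periodic, and $\mathbb{T}$ is modelled by $[-\pi,\pi)$. $\mathcal{B}_c(\mathbb{T})$ is the set of continuous $F:\mathbb{R}\to\mathbb{R}$ with $F(-\pi)=0$ and $F(y+2n\pi)=F(y)+nF(\pi)$ for all $y\in[-\pi,\pi)$, $n\in\mathbb{Z}$. $\mathcal{A}_c(\mathbb{T})$ is the set of Schwartz distributions $f$ on $\mathbb{R}$ such that $f=F'$ (distributional derivative) for some $F\in\mathcal{B}_c(\mathbb{T})$; this $F$ is unique and is called the primitive of $f$. The continuous primitive integral is $\int_a^bf=F(b)-F(a)$. Periodic locally Lebesgue integrable functions are identified with elements of $\mathcal{A}_c(\mathbb{T})$. The Alexiewicz norm is $\|f\|_{\mathbb{T}}=\sup_{|I|\le2\pi}\left|\int_If\right|$, supremum over intervals $I\subset\mathbb{R}$ of length at most $2\pi$. $\mathcal{BV}(\mathbb{T})$ is the set of periodic functions $g:\mathbb{R}\to\mathbb{R}$ of finite variation over $[-\pi,\pi]$. For $f\in\mathcal{A}_c(\mathbb{T})$ with primitive $F$ and $g\in\mathcal{BV}(\mathbb{T})$, $\int_{-\pi}^{\pi}fg=F(\pi)g(\pi)-\int_{-\pi}^{\pi}F\,dg$ (Riemann--Stieltjes integral), and $f\ast g(x)=\int_{-\pi}^{\pi}f(x-t)g(t)\,dt$, where $t\mapsto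 f(x-t)$ is the distribution $f\circ r_x\in\mathcal{A}_c(\mathbb{T})$, $r_x(t)=x-t$. A summability kernel is a sequence $\{k_n\}\subset\mathcal{BV}(\mathbb{T})$ such that $\int_{-\pi}^{\pi}k_n=1$ for all $n$; $\lim_{n\to\infty}\int_{\delta<|s|<\pi}|k_n(s)|\,ds=0$ for each $0<\delta\le\pi$; and there is $M\in\mathbb{R}$ with $\|k_n\|_1=\int_{-\pi}^{\pi}|k_n|\le M$ for all $n\in\mathbb{N}$. *)

(* Defs.v *)
From HB Require Import structures.
From mathcomp Require Import all_boot all_order all_algebra.
From mathcomp Require Import all_classical all_reals all_analysis.

Set Implicit Arguments.
Unset Strict Implicit.
Unset Printing Implicit Defensive.

Import Order.TTheory GRing.Theory Num.Theory.
Import numFieldNormedType.Exports.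

Local Open Scope classical_set_scope.
Local Open Scope ring_scope.

Section Smooth.
Context {R : realType}.
Implicit Types phi psi : R -> R.

Definition smooth phi :=
  forall (n : nat) (x : R), derivable (derive1n n phi) x 1.

Definition supp phi : set R := closure [set x | phi x != 0].

Lemma derive1n_lin (a : R) phi psi : smooth phi -> smooth psi ->
  forall n, derive1n n (a *: phi + psi) = a *: derive1n n phi + derive1n n psi.
Proof.
move=> sphi spsi; elim=> [//|n IHn].
rewrite !derive1nS IHn; apply/funext => x.
rewrite derive1E deriveD; [|exact: derivableZ|exact: spsi].
by rewrite deriveZ; [rewrite -!derive1E|exact: sphi].
Qed.

Lemma smooth_lin (a : R) phi psi : smooth phi -> smooth psi ->
  smooth (a *: phi + psi).
Proof.
move=> sphi spsi n x; rewrite derive1n_lin//.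
by apply: derivableD; [exact: derivableZ|exact: spsi].
Qed.

Lemma derive1n_cst0 n : derive1n n (0 : R -> R) = 0.
Proof.
elim: n => [//|n IHn]; rewrite derive1nS IHn.
by apply/funext => x; rewrite (derive1_cst (0 : R)).
Qed.

Lemma smooth0 : smooth (0 : R -> R).
Proof.
by move=> n x; rewrite derive1n_cst0; exact: (@derivable_cst _ _ _ (0 : R)).
Qed.

Lemma is_derive_refl (x t : R) phi : smooth phi -> forall n : nat,
  is_derive t 1 (fun s => (-1) ^+ n * derive1n n phi (x - s))
    ((-1) ^+ n.+1 * derive1n n.+1 phi (x - t)).
Proof.
move=> sphi n.
have dr : is_derive t 1 (fun s : R => x - s) (-1).
  by apply: is_derive_eq; rewrite add0r mul1r.
have dphi : is_derive (x - t) 1 (derive1n n phi) (derive1n n.+1 phi (x - t)).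
  by apply: DeriveDef; [exact: sphi|rewrite derive1nS derive1E].
have dc := @is_derive1_comp R (derive1n n phi) (fun s : R => x - s) t _ _ dphi dr.
have := is_deriveZ ((-1) ^+ n) dc.
rewrite (_ : (-1) ^+ n *: _ = (-1) ^+ n.+1 * derive1n n.+1 phi (x - t))//.
by rewrite exprSr /GRing.scale/= mulrAC mulrA.
Qed.

Lemma derive1n_refl (x : R) phi : smooth phi -> forall n,
  derive1n n (fun t => phi (x - t)) = fun t => (-1) ^+ n * derive1n n phi (x - t).
Proof.
move=> sphi; elim=> [|n IHn].
  by apply/funext => t; rewrite expr0 mul1r.
rewrite derive1nS IHn; apply/funext => t.
by rewrite derive1E; have /@derive_val := is_derive_refl x t sphi n.
Qed.

Lemma smooth_refl (x : R) phi : smooth phi -> smooth (fun t => phi (x - t)).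
Proof.
move=> sphi n t; rewrite derive1n_refl//.
by have /@ex_derive := is_derive_refl x t sphi n.
Qed.

Lemma smooth_derive phi : smooth phi -> smooth (derive1 phi).
Proof. by move=> sphi n x; rewrite -derive1Sn; exact: sphi. Qed.

Lemma compact_supp phi (K : set R) : compact K ->
  (forall x, ~ K x -> phi x = 0) -> compact (supp phi).
Proof.
move=> cK phiK; apply: (subclosed_compact _ cK); first exact: closed_closure.
have /closure_id -> : closed K by apply: compact_closed => //; exact: Rhausdorff.
apply: closure_subset => x /= /eqP phix.
by apply: contrapT => /phiK.
Qed.

Lemma supp0 phi x : ~ supp phi x -> phi x = 0.
Proof.
by move=> h; apply/eqP; apply: contra_notT h => h; exact: subset_closure.
Qed.

Lemma supp_lin (a : R) phi psi : compact (supp phi) -> compact (supp psi) ->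
  compact (supp (a *: phi + psi)).
Proof.
move=> cphi cpsi; apply: (compact_supp (compactU cphi cpsi)) => x.
move=> /not_orP[/supp0 h1 /supp0 h2].
by rewrite !fctE h1 h2 scaler0 addr0.
Qed.

Lemma supp_derive phi : compact (supp phi) -> compact (supp (derive1 phi)).
Proof.
move=> cphi; apply: (compact_supp cphi) => x nx.
rewrite derive1E; transitivity ('D_1 (cst 0 : R -> R) x); last exact: derive_cst.
apply: near_eq_derive.
have : nbhs x (~` supp phi).
  by apply: open_nbhs_nbhs; split => //; exact/closed_openC/closed_closure.
by apply: filterS => y /supp0.
Qed.

Lemma supp_refl (x : R) phi : compact (supp phi) ->
  compact (supp (fun t => phi (x - t))).
Proof.
move=> cphi.
have c : compact ((fun t => x - t) @` supp phi).
  apply: continuous_compact => //; apply: continuous_subspaceT => t.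
  by apply: cvgB; [exact: cvg_cst|exact: cvg_id].
apply: (compact_supp c) => t nt; apply: supp0 => h; apply: nt.
by exists (x - t) => //; rewrite subKr.
Qed.

Definition is_test : {pred R -> R} :=
  fun phi => `[< smooth phi /\ compact (supp phi) >].

Lemma is_test_submod_closed : submod_closed is_test.
Proof.
split.
  apply/asboolP; split; first exact: smooth0.
  by apply: (compact_supp (@compact0 _)) => x _.
move=> a phi psi /asboolP[s1 c1] /asboolP[s2 c2]; apply/asboolP.
by split; [exact: smooth_lin|exact: supp_lin].
Qed.

HB.instance Definition _ :=
  GRing.isSubmodClosed.Build _ _ is_test is_test_submod_closed.

End Smooth.

Record test_fun (R : realType) :=
  TestFun { test_val :> R -> R ; _ : test_val \in is_test }.
HB.instance Definition _ (R : realType) := [isSub for @test_val R].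
HB.instance Definition _ (R : realType) := [Choice of test_fun R by <:].
HB.instance Definition _ (R : realType) :=
  [SubChoice_isSubLmodule of test_fun R by <:].

Section TestFun.
Context {R : realType}.
Implicit Types (phi psi : test_fun R) (x : R).

Lemma test_deriv_subproof phi : derive1 phi \in is_test.
Proof.
case: phi => phi /= /asboolP[s c]; apply/asboolP.
by split; [exact: smooth_derive|exact: supp_derive].
Qed.

Definition test_deriv phi : test_fun R := TestFun (test_deriv_subproof phi).

Lemma test_refl_subproof x phi : (fun t => phi (x - t)) \in is_test.
Proof.
case: phi => phi /= /asboolP[s c]; apply/asboolP.
by split; [exact: smooth_refl|exact: supp_refl].
Qed.

Definition test_refl x phi : test_fun R := TestFun (test_refl_subproof x phi).

Definition cvg_test (u : nat -> test_fun R) phi :=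
  (exists2 K : set R, compact K & forall n, supp (u n) `<=` K) /\
  forall (m : nat) (e : R), 0 < e -> \forall n \near \oo,
    forall x, `|derive1n m (u n) x - derive1n m phi x| < e.

End TestFun.

Section Distributions.
Context {R : realType}.
Notation mu := (@lebesgue_measure R).
Implicit Types (T : test_fun R -> R) (h F : R -> R).

Definition distribution T :=
  (scalar T) /\
  forall (u : nat -> test_fun R) (phi : test_fun R),
    cvg_test u phi -> T (u n) @[n --> \oo] --> T phi.

(* Meaningful when h is locally integrable. *)
Definition regular_distr h : test_fun R -> R :=
  fun phi => \int[mu]_x (h x * phi x).

Definition distr_deriv T : test_fun R -> R := fun phi => - T (test_deriv phi).

(* The composition of T with t |-> x - t; the Jacobian factor is 1. *)
Definition distr_refl x T : test_fun R -> R := fun phi => T (test_refl x phi).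

End Distributions.

Section RiemannStieltjes.
Context {R : realType}.
Implicit Types (F g : R -> R) (a b v : R) (s t : seq R).

(* In the next three definitions a :: s lists the points of a partition
   (see [itv_partition]) and t lists one tag per cell. *)
Definition tagged a s t := size t = size s /\
  forall i, (i < size s)%N -> nth 0 (a :: s) i <= nth 0 t i <= nth 0 s i.

Definition mesh_lt a s (d : R) :=
  forall i, (i < size s)%N -> nth 0 s i - nth 0 (a :: s) i < d.

Definition RS_sum a F g s t : R :=
  \sum_(i < size s) F (nth 0 t i) * (g (nth 0 s i) - g (nth 0 (a :: s) i)).

Definition is_RS_integral a b F g v := forall e : R, 0 < e ->
  exists2 d : R, 0 < d & forall s t, itv_partition a b s -> tagged a s t ->
    mesh_lt a s d -> `|RS_sum a F g s t - v| < e.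

(* The integral of F dg over [a, b], with value 0 when it does not exist. *)
Definition RS_integral a b F g : R := xget 0 [set v | is_RS_integral a b F g v].

End RiemannStieltjes.

Section PeriodicPrimitiveIntegral.
Context {R : realType}.
Notation mu := (@lebesgue_measure R).
Implicit Types (f : test_fun R -> R) (F g h : R -> R).

Definition B_c : set (R -> R) := [set F : R -> R |
  [/\ continuous F, F (- pi) = 0 &
    forall (y : R) (n : int), - pi <= y < pi ->
      F (y + 2 * n%:~R * pi) = F y + n%:~R * F pi]].

Definition is_primitive f F := B_c F /\ f = distr_deriv (regular_distr F).

Definition A_c : set (test_fun R -> R) := [set f : test_fun R -> R |
  distribution f /\ exists F, is_primitive f F].

(* The primitive of f, with value 0 when f has none. *)
Definition primitive f : R -> R := xget 0 [set F | is_primitive f F].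

Definition cp_integral a b f : R := primitive f b - primitive f a.

(* The integral over a bounded interval depends only on its endpoints. *)
Definition alexiewicz_norm f : R :=
  sup [set r | exists a b : R,
    [/\ a <= b, b - a <= 2 * pi & r = `|cp_integral a b f|]].

Definition BV_T : set (R -> R) := [set g : R -> R |
  periodic g (2 * pi) /\ bounded_variation (- pi) pi g].

Definition cp_integral_mul f g : R :=
  primitive f pi * g pi - RS_integral (- pi) pi (primitive f) g.

Definition convolution f g : R -> R :=
  fun x => cp_integral_mul (distr_refl x f) g.

Definition loc_integrable_T : set (R -> R) := [set h : R -> R |
  periodic h (2 * pi) /\ locally_integrable setT h].

Definition summability_kernel (k : nat -> R -> R) :=
  [/\ forall n, BV_T (k n),
      forall n, \int[mu]_(s in `[- pi, pi]) k n s = 1,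
      forall delta : R, 0 < delta -> delta <= pi ->
        \int[mu]_(s in [set s | delta < `|s| < pi]) `|k n s|
          @[n --> \oo] --> (0 : R) &
      exists M : R, forall n, \int[mu]_(s in `[- pi, pi]) `|k n s| <= M].

End PeriodicPrimitiveIntegral.

(* Main.v *)
Require Import Defs.
From mathcomp Require Import all_boot all_order all_algebra.
From mathcomp Require Import all_classical all_reals all_analysis.
From mathcomp Require Import measurable_realfun ring lra.

Set Implicit Arguments.
Unset Strict Implicit.
Unset Printing Implicit Defensive.

Import Order.TTheory GRing.Theory Num.Theory.
Import numFieldNormedType.Exports.

Local Open Scope classical_set_scope.
Local Open Scope ring_scope.

(** Let [F] be the primitive of [f] and let [W x] be the Lebesgue integral of
    [F (x - t) * g t] over one period ([period_conv]). The heart of the matter is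
    that [W] is an antiderivative of the convolution of [f] and [g]
    ([is_derive_period_conv]): the primitive of a convolution is the convolution of
    the primitive. When [g] has integral [1], the primitive of the difference of
    that convolution and [f] is therefore [W - F] up to a constant
    ([is_primitive_convolutionB]), and [W x - F x] is the integral of
    [(F (x - t) - F x) * g t] over one period. The classical approximate identity
    argument now applies ([period_conv_sub_le]): [F] is uniformly continuous and
    its increments over at most half a period are bounded, since [F] is periodic
    up to a linear term. This makes [W - F] small uniformly in [x], and the
    Alexiewicz norm is at most twice the supremum of [`|W - F|].

    That [W] has the right derivative is read off difference quotients. If [G] is
    an antiderivative of [F], then [h^-1 * (G (s + h) - G s)] is C1 and uniformly
    close to [F]. The Riemann-Stieltjes integral of a C1 function is given by
    integration by parts ([RS_sum_C1]), and for this approximation the formula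
    yields exactly the difference quotient of [W]; on the other hand a
    Riemann-Stieltjes integral changes little when the integrand does
    ([is_RS_integral_dist]). So the difference quotients of [W] converge to the
    convolution, even uniformly, which also makes the convolution continuous
    ([convolution_difference_quotient]). The same approximation shows that
    continuous functions have Riemann-Stieltjes integrals against functions of
    bounded variation ([is_RS_integral_continuous]).

    Since the primitive of a distribution is picked among all candidates, every
    computation of a primitive rests on uniqueness ([primitive_unique]), that is, on
    the du Bois-Reymond lemma: a continuous function whose distributional
    derivative is zero is constant ([du_bois_reymond]). It calls for enough test
    functions, and these are made from the flat function [expR (- x^-1)]
    ([smooth_step]). *)

(** * Calculus on the line *)

Section Calculus.
Context {R : realType}.
Notation mu := (@lebesgue_measure R).
Implicit Types (f g F G : R -> R) (a b x y : R).

Lemma continuous_itv_integrable f a b : continuous f ->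
  mu.-integrable `[a, b] (EFin \o f).
Proof.
move=> cf; apply: continuous_compact_integrable; first exact: segment_compact.
exact: continuous_subspaceT.
Qed.

Lemma is_derive_continuous f g :
  (forall x, is_derive x 1 f (g x)) -> continuous f.
Proof.
move=> df x; apply: differentiable_continuous.
by apply/derivable1_diffP; exact: ex_derive.
Qed.

Lemma continuous_comp_refl F x : continuous F -> continuous (fun t : R => F (x - t)).
Proof.
move=> cF t; apply: (@continuous_comp _ _ _ (fun t : R => x - t) F); last exact: cF.
by apply: cvgB; [exact: cvg_cst|exact: cvg_id].
Qed.

Lemma is_derive_derivable f x (c : R) : is_derive x 1 f c -> derivable f x 1.
Proof. by case. Qed.

Lemma is_derive_derive1 f x (c : R) : is_derive x 1 f c -> derive1 f x = c.
Proof. by move=> df; rewrite derive1E derive_val. Qed.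

Lemma is_derive_comp_shift f (h x c : R) : is_derive (x + h) 1 f c ->
  is_derive x 1 (fun y => f (y + h)) c.
Proof.
move=> df; have dr : is_derive x 1 (fun y : R => y + h) 1.
  exact: is_derive_shift.
by have := @is_derive1_comp R f (fun y => y + h) x _ _ df dr; rewrite mulr1.
Qed.

Lemma is_derive_comp_refl f (h x c : R) : is_derive (h - x) 1 f c ->
  is_derive x 1 (fun y => f (h - y)) (- c).
Proof.
move=> df; have dr : is_derive x 1 (fun y : R => h - y) (-1).
  by apply: is_derive_eq; rewrite add0r mul1r.
by have := @is_derive1_comp R f (fun y => h - y) x _ _ df dr; rewrite mulrN1.
Qed.

Lemma Rintegral_is_derive F f a b : a <= b -> continuous f ->
  (forall x, is_derive x 1 F (f x)) ->
  \int[mu]_(x in `[a, b]) f x = F b - F a.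
Proof.
rewrite le_eqVlt => /predU1P[<- _ _|ab cf dF].
  by rewrite set_itv1 Rintegral_set1 subrr.
have cF := is_derive_continuous dF.
rewrite /Rintegral (@continuous_FTC2 _ f F)//.
- exact: continuous_subspaceT.
- split.
  + by move=> x _; exact: ex_derive.
  + by apply: cvg_at_right_filter; exact: cF.
  + by apply: cvg_at_left_filter; exact: cF.
- by move=> x _; rewrite derive1E derive_val.
Qed.

Lemma Rintegral_itv_chasles f a c b : a <= c <= b ->
  mu.-integrable `[a, b] (EFin \o f) ->
  \int[mu]_(x in `[a, b]) f x =
    \int[mu]_(x in `[a, c]) f x + \int[mu]_(x in `[c, b]) f x.
Proof.
move=> /andP[ac cb] fi.
rewrite -(@Rintegral_itv_obnd_cbnd _ c); last first.
  by apply: integrableS fi => //; apply: subset_itvr; rewrite bnd_simp.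
by rewrite -(@Rintegral_itvB _ f (BLeft a))// subrKC.
Qed.

(** The integral from a fixed base point is only an antiderivative to the right
    of that point. The base point [- (`|y| + 1)] moves with the argument [y];
    by additivity this changes the integral by a constant, which subtracting
    the value at [0] removes. *)
Lemma continuous_antiderivative f : continuous f ->
  exists F : R -> R, forall x, is_derive x 1 F (f x).
Proof.
move=> cf.
pose G (N y : R) := \int[mu]_(t in `[- N, y]) f t.
have GE N M y z : M <= N -> - M <= y -> - M <= z -> G N y - G N z = G M y - G M z.
  move=> MN My Mz; rewrite /G.
  rewrite (@Rintegral_itv_chasles f (- N) (- M) y) ?lerN2 ?MN//; last first.
    exact: continuous_itv_integrable.
  rewrite (@Rintegral_itv_chasles f (- N) (- M) z) ?lerN2 ?MN//; last first.
    exact: continuous_itv_integrable.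
  lra.
exists (fun y => G (`|y| + 1) y - G (`|y| + 1) 0) => x.
set N := `|x| + 2.
have dG : is_derive x 1 (fun y => G N y - G N 0) (f x).
  have Nx : - N < x.
    by rewrite /N; have := ler_norm (- x); rewrite normrN; lra.
  have xx1 : x < x + 1 by rewrite ltrDl.
  have [dG eG] := @continuous_FTC1_closed _ f (- N) x (x + 1) xx1
    (continuous_itv_integrable _ _ cf) Nx (cf x).
  have dG' : is_derive x 1 (G N) (f x).
    by apply: DeriveDef; [exact: dG|rewrite -derive1E; exact: eG].
  by apply: is_derive_eq; rewrite subr0.
apply: (near_eq_is_derive (f := fun y => G N y - G N 0)).
near=> y.
have yx : `|y| <= `|x| + 1.
  have : `|x - y| <= 1.
    by near: y; apply: cvgr_dist_le => //; exact: cvg_id.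
  by have := lerB_dist y x; rewrite distrC; lra.
apply: GE.
- by rewrite /N; lra.
- by have := ler_norm (- y); rewrite normrN; lra.
- by have := normr_ge0 y; lra.
Unshelve. all: by end_near. Qed.


Lemma itv_integrableB f g a b : mu.-integrable `[a, b] (EFin \o f) ->
  mu.-integrable `[a, b] (EFin \o g) ->
  mu.-integrable `[a, b] (EFin \o (fun x => f x - g x)).
Proof. by move=> fi gi; apply: integrableB fi gi. Qed.

Lemma bounded_itv_integrable f a b (M : R) : measurable_fun `[a, b] f ->
  (forall x, a <= x <= b -> `|f x| <= M) -> mu.-integrable `[a, b] (EFin \o f).
Proof.
move=> mf fM; apply: measurable_bounded_integrable => //.
- by rewrite /= lebesgue_measure_itv/=; case: ifP => _; rewrite ?ltry// -EFinB ltry.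
- exists M; split; first exact: num_real.
  move=> N MN x /=; rewrite in_itv/= => /fM xM.
  by rewrite (le_trans xM)// ltW.
Qed.

Lemma Rintegral_itv_cst a b (c : R) : a <= b ->
  \int[mu]_(x in `[a, b]) c = c * (b - a).
Proof.
move=> ab; rewrite Rintegral_cst//= lebesgue_measure_itv/= lte_fin.
move: ab; rewrite le_eqVlt => /predU1P[->|ab]; first by rewrite ltxx subrr.
by rewrite ab.
Qed.

Lemma norm_Rintegral_itv_le f a b (K : R) : a <= b ->
  mu.-integrable `[a, b] (EFin \o f) ->
  (forall x, a <= x <= b -> `|f x| <= K) ->
  `|\int[mu]_(x in `[a, b]) f x| <= K * (b - a).
Proof.
move=> ab fi fK; rewrite (le_trans (le_normr_Rintegral _ fi))//.
rewrite -Rintegral_itv_cst//.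
have ifn : mu.-integrable `[a, b] (EFin \o (fun x => `|f x|)).
  exact: (integrable_norm fi).
have ik : mu.-integrable `[a, b] (EFin \o (fun=> K)).
  by apply: continuous_itv_integrable => x; exact: cvg_cst.
exact: (le_Rintegral _ ifn ik).
Qed.

Lemma continuous_bounded_itv f a b : continuous f ->
  exists2 M, 0 < M & forall x, a <= x <= b -> `|f x| <= M.
Proof.
move=> cf; have [ab|ba] := leP a b; last first.
  by exists 1 => // x /andP[ax xb]; move: ba; rewrite ltNge (le_trans ax xb).
have [c _ hc] := @EVT_max R (fun x => `|f x|) a b ab
  (continuous_subspaceT (fun x => cvg_norm (cf x))).
exists (`|f c| + 1); first by rewrite ltr_pwDr.
by move=> x xab; rewrite (le_trans (hc x _)) ?in_itv// lerDl.
Qed.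

(** Heine-Cantor: by compactness one radius serves all centres. The second
    point may leave the segment, which is what approximating a function near
    the end points requires. *)
Lemma continuous_uniform_itv f a b (e : R) : continuous f -> 0 < e ->
  exists2 d, 0 < d & forall x y, a <= x <= b -> `|y - x| < d -> `|f y - f x| < e.
Proof.
move=> cf e0.
have key (x x' y d r : R) : (forall z, `|x - z| < r -> `|f x - f z| < e / 2) ->
    `|x - x'| < r / 2 -> d < r / 2 -> `|y - x'| < d -> `|f y - f x'| < e.
  move=> hr xx' dr yx'.
  have h1 : `|f x - f x'| < e / 2 by apply: hr; have := normr_ge0 (x - x'); lra.
  have h2 : `|f x - f y| < e / 2.
    by apply: hr; have := ler_distD x' x y; rewrite (distrC x' y); lra.
  by have := ler_distD (f x) (f y) (f x'); rewrite (distrC (f y) (f x)); lra.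
have /compact_near_coveringP cov := @segment_compact R a b.
have h : \forall d \near 0^'+, `[a, b] `<=`
    [set x | forall y, `|y - x| < d -> `|f y - f x| < e].
  apply: (cov _ (0:R)^'+ (fun d x => forall y, `|y - x| < d -> `|f y - f x| < e)).
  move=> x _.
  have /cvgrPdist_lt /(_ (e / 2)) := cf x.
  rewrite divr_gt0// => /(_ isT) /nbhs_ballP[r /= r0 hr].
  exists (ball x (r / 2), [set d | d < r / 2]) => /=.
    split; first by apply: nbhsx_ballx; rewrite divr_gt0.
    by apply: nbhs_right_lt; rewrite divr_gt0.
  by move=> [x' d] [/= xx' dr] y yx'; exact: (key x x' y d r).
near (0 : R)^'+ => d.
exists d; first by near: d; exact: nbhs_right_gt.
by move=> x y xab; apply: (near h d) => //=; rewrite in_itv.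
Unshelve. all: by end_near. Qed.

(** The difference quotients of an antiderivative of [f] are averages of [f]:
    they are C1 approximations of [f], and their derivatives are difference
    quotients of [f] itself. *)
Lemma mean_dist F f x (h e : R) : (forall y, is_derive y 1 F (f y)) ->
  h != 0 ->
  (forall y, `|y - x| <= `|h| -> `|f y - f x| <= e) ->
  `|h^-1 * (F (x + h) - F x) - f x| <= e.
Proof.
move=> dF h0 fe; have cF := is_derive_continuous dF.
have [y yx ->] : exists2 y, `|y - x| <= `|h| & F (x + h) - F x = f y * h.
  have [hpos|hneg] := leP 0 h.
  - have [|y yx E] := @MVT_segment R F f x (x + h) _ (fun y _ => dF y)
      (continuous_subspaceT cF); first by rewrite lerDl.
    exists y; last by rewrite E addrAC subrr add0r.
    move: yx; rewrite in_itv/= => /andP[xy yxh].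
    by rewrite !ger0_norm ?subr_ge0//; lra.
  - have [|y yx E] := @MVT_segment R F f (x + h) x _ (fun y _ => dF y)
      (continuous_subspaceT cF); first by rewrite gerDl ltW.
    exists y; last by rewrite -opprB E; ring.
    move: yx; rewrite in_itv/= => /andP[xy yxh].
    by rewrite !ler0_norm ?subr_le0//; lra.
by rewrite mulrC mulfK//; exact: fe.
Qed.

End Calculus.

(** * Test functions and the du Bois-Reymond lemma *)

Section SmoothClosure.
Context {R : realType}.
Implicit Types (f g : R -> R) (n : nat) (x : R).

(** Smoothness peels off derivatives from the outside, whereas the product and
    chain rules express the innermost derivative; this inductive form makes
    induction on the order of differentiability work. *)
Fixpoint diffn n f : Prop :=
  (forall x, derivable f x 1) /\ if n is m.+1 then diffn m (derive1 f) else True.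

Lemma diffnW n f : diffn n.+1 f -> diffn n f.
Proof. by elim: n f => [|n IHn] f [df]; [case|move=> /IHn]. Qed.

Lemma smoothP f : smooth f <-> forall n, diffn n f.
Proof.
split=> [sf n|df n].
  elim: n => [|n IHn] in f sf *; first by split=> //; exact: (sf 0%N).
  by split; [exact: (sf 0%N)|apply: IHn; exact: smooth_derive].
elim: n => [|n IHn] in f df *; first by case: (df 0%N).
by rewrite derive1Sn; apply: IHn => m; case: (df m.+1).
Qed.

Lemma diffn_cst n (c : R) : diffn n (fun=> c).
Proof.
elim: n => [|n IHn] in c *; first by split=> // x; exact: derivable_cst.
split=> [x|]; first exact: derivable_cst.
by rewrite (_ : derive1 _ = fun=> 0)//; apply/funext => x; rewrite (derive1_cst c).
Qed.

Lemma diffnD n f g : diffn n f -> diffn n g -> diffn n (f \+ g).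
Proof.
elim: n => [|n IHn] in f g *.
  by move=> [df _] [dg _]; split=> [x|//]; exact: derivableD (df x) (dg x).
move=> [df df'] [dg dg']; split=> [x|]; first exact: derivableD.
rewrite (_ : derive1 _ = derive1 f \+ derive1 g); first exact: IHn.
by apply/funext => x; rewrite derive1E (deriveD (df x) (dg x)) -!derive1E.
Qed.

Lemma diffnM n f g : diffn n f -> diffn n g -> diffn n (f \* g).
Proof.
elim: n => [|n IHn] in f g *.
  by move=> [df _] [dg _]; split=> [x|//]; exact: derivableM (df x) (dg x).
move=> /[dup] /diffnW wf [df df'] /[dup] /diffnW wg [dg dg'].
split=> [x|]; first exact: derivableM.
rewrite (_ : derive1 _ = (f \* derive1 g) \+ (g \* derive1 f)).
  by apply: diffnD; exact: IHn.
by apply/funext => x; rewrite derive1E (deriveM (df x) (dg x)) -!derive1E.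
Qed.

Lemma diffn_comp n f g : diffn n f -> diffn n g -> diffn n (f \o g).
Proof.
have dE (h : R -> R) x : derivable h x 1 -> is_derive x 1 h ((derive1 h) x).
  by move=> dh; apply: DeriveDef; [exact: dh|rewrite derive1E].
elim: n => [|n IHn] in f g *.
  move=> [df _] [dg _]; split=> [x|//].
  exact: (is_derive_derivable (is_derive1_comp (dE _ _ (df (g x))) (dE _ _ (dg x)))).
move=> [df df'] /[dup] /diffnW wg [dg dg'].
have d x := is_derive1_comp (dE _ _ (df (g x))) (dE _ _ (dg x)).
split=> [x|]; first exact: (is_derive_derivable (d x)).
rewrite (_ : derive1 _ = (derive1 f \o g) \* derive1 g).
  by apply: diffnM => //; exact: IHn.
by apply/funext => x; exact: (is_derive_derive1 (d x)).
Qed.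

Lemma smooth_continuous f : smooth f -> continuous f.
Proof.
move=> sf x; apply: differentiable_continuous; apply/derivable1_diffP.
exact: (sf 0%N).
Qed.

End SmoothClosure.

Section Bump.
Context {R : realType}.
Implicit Types (x y : R) (n m : nat).

(** The powers of [x^-1] are there so that the linear span of the family is
    closed under differentiation. *)
Definition flat n x : R := if 0 < x then x^-1 ^+ n * expR (- x^-1) else 0.

Lemma flat_le0 n x : x <= 0 -> flat n x = 0.
Proof. by move=> x0; rewrite /flat ltNge x0. Qed.

Lemma flat_gt0 n x : 0 < x -> 0 < flat n x.
Proof. by move=> x0; rewrite /flat x0 mulr_gt0 ?expR_gt0 ?exprn_gt0 ?invr_gt0. Qed.

(** The exponential series gives [y ^+ n.+1 * expR (- y) <= n.+1`!] for
    [y = x^-1]; this linear bound is all that continuity at [0] needs. *)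
Lemma flat_norm_le n x : `|flat n x| <= n.+1`!%:R * `|x|.
Proof.
have [x0|x0] := leP x 0; first by rewrite flat_le0// normr0 mulr_ge0.
rewrite !gtr0_norm ?flat_gt0// /flat x0.
have y0 : 0 < x^-1 by rewrite invr_gt0.
have := expR_ge1Dxn n (ltW y0) => h.
have {}h : x^-1 ^+ n.+1 <= expR x^-1 * n.+1`!%:R.
  rewrite -ler_pdivrMr ?ltr0n ?fact_gt0//; apply: le_trans h.
  by rewrite lerDr.
rewrite expRN ler_pdivrMr ?expR_gt0//.
rewrite -(ler_pM2l y0) -exprS (le_trans h)//.
rewrite le_eqVlt; apply/orP; left; apply/eqP.
by field; rewrite gt_eqF.
Qed.

Lemma cvg_flat0 n : flat n x @[x --> 0^'] --> (0 : R).
Proof.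
apply/cvgrPdist_le => e e0.
have c0 : 0 < n.+1`!%:R :> R by rewrite ltr0n fact_gt0.
near=> x; rewrite sub0r normrN (le_trans (flat_norm_le n x))//.
rewrite mulrC -ler_pdivlMr//.
near: x; apply: dnbhs0_le; exact: divr_gt0.
Unshelve. all: by end_near. Qed.

(** At [0] the difference quotient of [flat n] is [flat n.+1], so that
    derivability at [0] is the continuity of the next function there. *)
Lemma is_derive_flat n x :
  is_derive x 1 (flat n) (flat n.+2 x + (- n%:R) * flat n.+1 x).
Proof.
have [x0|x0|->] := ltgtP x 0.
- rewrite !flat_le0 ?(ltW x0)// mulr0 addr0.
  have E : \forall y \near x, cst (0 : R) y = flat n y.
    by near=> y; rewrite flat_le0//; near: y; exact: lt_le_nbhsl.
  exact: near_eq_is_derive E (is_derive_cst (0 : R) x 1).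
- have E : \forall y \near x, y^-1 ^+ n * expR (- y^-1) = flat n y.
    by near=> y; rewrite /flat ifT//; near: y; exact: lt_nbhsr.
  apply: near_eq_is_derive E _.
  have xN0 : x != 0 by rewrite gt_eqF.
  have dV := @is_deriveV R id x 1 1 xN0 (is_derive_id x 1).
  have dNV := is_deriveN dV.
  have dE := @is_derive1_comp R expR (fun y : R => - y^-1) x _ _
     (is_derive_expR _) dNV.
  have dX := is_deriveX n dV.
  rewrite (_ : (fun y => _) =
      (fun y : R => y^-1) ^+ n * (expR \o (fun y : R => - y^-1))); last first.
    by apply/funext => y; rewrite !fctE.
  apply: (@is_derive_eq _ _ _ _ _ _ _ _ (is_deriveM dX dE)).
  have XE : ((fun y : R => y^-1) ^+ n) x = x^-1 ^+ n by rewrite !fctE.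
  rewrite XE /flat x0 /GRing.scale/=.
  case: n {dX XE} => [|n]; first by field.
  by rewrite /= !exprS; field.
- rewrite !flat_le0// mulr0 addr0.
  have h : (fun h : R => h^-1 *: (flat n (h *: 1 + 0) - flat n 0)) @ 0^' --> (0 : R).
    apply: cvg_trans (cvg_flat0 n.+1).
    apply: near_eq_cvg; near=> y.
    rewrite addr0 (flat_le0 n (lexx 0)) subr0 /GRing.scale/= mulr1.
    rewrite /flat; case: ifP => _; last by rewrite mulr0.
    by rewrite exprS mulrA.
  by apply: DeriveDef; [apply/cvg_ex; exists 0|exact/cvg_lim].
Unshelve. all: by end_near. Qed.

Lemma diffn_flat m n : diffn m (flat n).
Proof.
elim: m n => [|m IHm] n; split=> //.
- by move=> x; exact: (is_derive_derivable (is_derive_flat n x)).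
- by move=> x; exact: (is_derive_derivable (is_derive_flat n x)).
rewrite (_ : derive1 _ = flat n.+2 \+ (cst (- n%:R) \* flat n.+1)).
  by apply: diffnD => //; apply: diffnM => //; exact: diffn_cst.
by apply/funext => x; exact: (is_derive_derive1 (is_derive_flat n x)).
Qed.

Lemma flat0_homo : {homo flat 0 : x y / x <= y}.
Proof.
move=> x y xy; have [x0|x0] := leP x 0.
  rewrite flat_le0//; have [y0|y0] := leP y 0; first by rewrite flat_le0.
  by rewrite ltW// flat_gt0.
have y0 := lt_le_trans x0 xy.
by rewrite /flat x0 y0 !expr0 !mul1r ler_expR lerN2 lef_pV2.
Qed.

(** The function [flat 0 (flat 0 1 - flat 0 u)] is constant both for [u <= 0],
    where [flat 0 u] vanishes, and for [1 <= u], where the argument of the outer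
    function is not positive. An affine change of variable and a normalization
    turn it into the required step. *)
Lemma smooth_step (a b : R) : a < b -> exists theta : R -> R,
  [/\ smooth theta, {homo theta : x y /~ x <= y},
      forall x, x <= a -> theta x = 1 & forall x, b <= x -> theta x = 0].
Proof.
move=> ab; have ba0 : 0 < b - a by rewrite subr_gt0.
pose c := flat 0 1; have c0 : 0 < c by exact: flat_gt0.
have k0 : 0 < flat 0 c by exact: flat_gt0.
pose u x := (b - a)^-1 * (x + - a).
exists (cst (flat 0 c)^-1 \* (flat 0 \o (cst c \+ (cst (-1) \* (flat 0 \o u))))); split.
- apply/smoothP => n; apply: diffnM; first exact: diffn_cst.
  apply: diffn_comp; first exact: diffn_flat.
  apply: diffnD; first exact: diffn_cst.
  apply: diffnM; first exact: diffn_cst.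
  apply: diffn_comp; first exact: diffn_flat.
  have du : forall x, is_derive x 1 u (b - a)^-1.
    move=> x; have := is_deriveZ (b - a)^-1 (is_derive_shift x 1 (- a)).
    by rewrite /GRing.scale/= mulr1.
  have dx x : derivable u x 1 by exact: (is_derive_derivable (du x)).
  case: n => [//|n]; split => //.
  rewrite (_ : derive1 _ = cst (b - a)^-1); first exact: diffn_cst.
  by apply/funext => x; exact: (is_derive_derive1 (du x)).
- move=> x y yx /=; rewrite ler_pM2l ?invr_gt0//; apply: flat0_homo.
  rewrite lerD2l !mulN1r lerN2; apply: flat0_homo.
  by rewrite ler_pM2l ?invr_gt0// lerD2r.
- move=> x xa /=; rewrite (flat_le0 _ (_ : u x <= 0)); last first.
    by rewrite pmulr_rle0 ?invr_gt0// subr_le0.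
  by rewrite mulr0 addr0 mulVf// gt_eqF.
- move=> x bx /=; rewrite (flat_le0 _ (_ : c + _ <= 0)) ?mulr0//.
  rewrite mulN1r subr_le0; apply: flat0_homo.
  by rewrite /u mulrC ler_pdivlMr// mul1r lerD2r.
Qed.

End Bump.

Section DuBoisReymond.
Context {R : realType}.
Notation mu := (@lebesgue_measure R).
Implicit Types (F G theta : R -> R) (a b c d e x y A B : R).

Lemma Rintegral_support F a b : (forall x, ~~ (a <= x <= b) -> F x = 0) ->
  \int[mu]_x F x = \int[mu]_(x in `[a, b]) F x.
Proof.
move=> F0; rewrite [RHS]Rintegral_mkcond; apply: eq_Rintegral => x _.
rewrite patchE; case: ifPn => //; rewrite notin_setE/= in_itv/= => /negP.
exact: F0.
Qed.

Lemma smooth_is_derive F x : smooth F -> is_derive x 1 F (derive1 F x).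
Proof. by move=> sF; apply: DeriveDef; [exact: (sF 0%N)|rewrite derive1E]. Qed.

Lemma derive1_locally_cst F c x : (\forall y \near x, F y = c) -> derive1 F x = 0.
Proof.
move=> Fc; rewrite derive1E (@near_eq_derive _ _ _ F (cst c) x 1 Fc).
exact: derive_cst.
Qed.

Lemma nonincreasing_derive1_le0 F x : derivable F x 1 ->
  {homo F : x y /~ x <= y} -> derive1 F x <= 0.
Proof.
move=> dF mF; apply: limr_le.
  under eq_fun; first (move=> h; rewrite -{2}(scaler1 h); over).
  exact: dF.
near=> h; have h0 : h != 0 by near: h; exact: nbhs_dnbhs_neq.
move: h0; rewrite neq_lt => /orP[h0|h0]; rewrite /GRing.scale/=.
- by rewrite nmulr_rle0 ?invr_lt0// subr_ge0; apply: mF; rewrite gerDr ltW.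
- by rewrite pmulr_rle0 ?invr_gt0// subr_le0; apply: mF; rewrite lerDr ltW.
Unshelve. all: by end_near. Qed.

(** Since [theta] decreases from [1] to [0], [- theta^`()] is a probability
    density concentrated on [[c, c + d]]. *)
Lemma Rintegral_mul_derive_step G theta A B c d e : continuous G ->
  smooth theta -> {homo theta : x y /~ x <= y} ->
  (forall x, x <= c -> theta x = 1) -> (forall x, c + d <= x -> theta x = 0) ->
  A <= c -> 0 < d -> c + d <= B ->
  (forall y, `|y - c| <= d -> `|G y - G c| <= e) ->
  `|\int[mu]_(x in `[A, B]) (G x * derive1 theta x) + G c| <= e.
Proof.
move=> cG sth mth th1 th0 Ac d0 dB Ge.
have AB : A <= B by lra.
have cth : continuous (derive1 theta) by exact/smooth_continuous/smooth_derive.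
have dth x := smooth_is_derive x sth.
have Ith : \int[mu]_(x in `[A, B]) derive1 theta x = -1.
  by rewrite (Rintegral_is_derive AB cth dth) th0// th1// sub0r.
have cM (H : R -> R) : continuous H -> continuous (fun x => H x * derive1 theta x).
  by move=> cH x; apply: cvgM; [exact: cH|exact: cth].
have iM (H : R -> R) : continuous H ->
    mu.-integrable `[A, B] (EFin \o (fun x => H x * derive1 theta x)).
  by move=> cH; apply: continuous_itv_integrable; exact: cM.
have cc (k : R) : continuous (fun _ : R => k) by move=> x; exact: cvg_cst.
have ith : mu.-integrable `[A, B] (EFin \o derive1 theta).
  exact: continuous_itv_integrable.
have -> : \int[mu]_(x in `[A, B]) (G x * derive1 theta x) + G c =
    \int[mu]_(x in `[A, B]) ((G x - G c) * derive1 theta x).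
  transitivity (\int[mu]_(x in `[A, B]) (G x * derive1 theta x) -
      \int[mu]_(x in `[A, B]) (G c * derive1 theta x)).
    by rewrite RintegralZl// Ith mulrN1 opprK.
  rewrite -RintegralB//; [|exact: iM|exact: (iM (fun=> G c))].
  by apply: eq_Rintegral => x _; rewrite mulrBl.
have dle0 x : derive1 theta x <= 0 by exact: nonincreasing_derive1_le0.
have dout x : ~~ (c <= x <= c + d) -> derive1 theta x = 0.
  rewrite negb_and -!ltNge => /orP[xc|xcd].
    apply: (@derive1_locally_cst _ 1); near=> y; apply: th1.
    by near: y; exact: lt_le_nbhsl.
  apply: (@derive1_locally_cst _ 0); near=> y; apply: th0.
  by near: y; exact: lt_le_nbhsr.
have iGc : mu.-integrable `[A, B] (EFin \o (fun x => (G x - G c) * derive1 theta x)).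
  by apply: (iM (fun x => G x - G c)) => x; apply: cvgB; [exact: cG|exact: cvg_cst].
apply: le_trans (le_normr_Rintegral _ iGc) _ => //.
have -> : e = \int[mu]_(x in `[A, B]) (- e * derive1 theta x).
  by rewrite RintegralZl// Ith mulrN1 opprK.
apply: le_Rintegral => //; [exact: (integrable_norm iGc)|exact: (iM (fun=> - e))|].
move=> x _; rewrite normrM (ler0_norm (dle0 x)) mulrN mulNr lerN2.
have [cx|/dout ->] := boolP (c <= x <= c + d); last by rewrite !mulr0.
rewrite ler_wnM2r//; apply: Ge; rewrite ler_norml; lra.
Unshelve. all: by end_near. Qed.

(** The difference of a smooth step at [b] and a smooth step at [a] is a test
    function, and its derivative is nearly the difference of the Dirac masses
    at [a] and at [b]; the hypothesis thus forces [G a = G b]. *)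
Lemma du_bois_reymond G : continuous G ->
  (forall phi : test_fun R, \int[mu]_x (G x * derive1 phi x) = 0) ->
  forall a b, G a = G b.
Proof.
move=> cG G0.
have main a b : a < b -> G a = G b.
  move=> ab; apply/eqP; rewrite -subr_eq0 -normr_le0.
  apply/ler_addgt0Pr => e e0; rewrite add0r.
  have e20 : 0 < e / 2 by rewrite divr_gt0.
  have [d d0 hd] := continuous_uniform_itv a b cG e20.
  pose h := d / 2; have h0 : 0 < h by rewrite divr_gt0.
  have [|ta [sa ma ta1 ta0]] := @smooth_step R a (a + h); first by rewrite ltrDl.
  have [|tb [sb mb tb1 tb0]] := @smooth_step R b (b + h); first by rewrite ltrDl.
  have close c : a <= c <= b -> forall y, `|y - c| <= h -> `|G y - G c| <= e / 2.
    move=> cab y yc; apply/ltW/hd => //; rewrite (le_lt_trans yc)//.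
    by rewrite /h; lra.
  pose phi0 : R -> R := (-1) *: ta + tb.
  have out x : ~~ (a <= x <= b + h) -> phi0 x = 0.
    rewrite /phi0 !fctE /GRing.scale/= mulN1r negb_and -!ltNge => /orP[xa|bx].
      by rewrite ta1 ?(ltW xa)// tb1 ?addNr// ltW// (lt_trans xa).
    by rewrite ta0 ?tb0 ?oppr0 ?addr0// ltW// (lt_trans _ bx)// ltrD2r.
  have tphi : phi0 \in is_test.
    apply/asboolP; split; first exact: smooth_lin.
    apply: (compact_supp (@segment_compact _ a (b + h))) => x /=.
    by rewrite in_itv/= => /negP; exact: out.
  have ct t : smooth t -> continuous (derive1 t).
    by move=> st; exact/smooth_continuous/smooth_derive.
  have it t : smooth t ->
      mu.-integrable `[a, b + h] (EFin \o (fun x => G x * derive1 t x)).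
    move=> st; apply: continuous_itv_integrable => x.
    by apply: cvgM; [exact: cG|exact: ct].
  have := G0 (TestFun tphi); rewrite /=.
  rewrite (@Rintegral_support _ a (b + h)); last first.
    move=> x; rewrite negb_and -!ltNge => xout.
    rewrite (@derive1_locally_cst _ 0) ?mulr0//.
    case/orP: xout => [xa|bx]; near=> y; apply: out; rewrite negb_and -!ltNge.
      by apply/orP; left; near: y; exact: lt_nbhsl.
    by apply/orP; right; near: y; exact: lt_nbhsr.
  have -> : \int[mu]_(x in `[a, b + h]) (G x * derive1 phi0 x) =
      \int[mu]_(x in `[a, b + h]) (G x * derive1 tb x) -
      \int[mu]_(x in `[a, b + h]) (G x * derive1 ta x).
    rewrite -RintegralB//; [|exact: it|exact: it].
    apply: eq_Rintegral => x _; have := @derive1n_lin R (-1) ta tb sa sb 1%N.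
    rewrite !derive1n1 -/phi0 => ->.
    by rewrite !fctE /GRing.scale/=; ring.
  have lab := ltW ab; have abh : a + h <= b + h by rewrite lerD2r.
  have clo_a : forall y, `|y - a| <= h -> `|G y - G a| <= e / 2.
    by apply: close; rewrite lexx.
  have clo_b : forall y, `|y - b| <= h -> `|G y - G b| <= e / 2.
    by apply: close; rewrite lexx andbT.
  have := Rintegral_mul_derive_step cG sb mb tb1 tb0 lab h0 (lexx _) clo_b.
  have := Rintegral_mul_derive_step cG sa ma ta1 ta0 (lexx a) h0 abh clo_a.
  set Ia := \int[mu]_(_ in _) _; set Ib := \int[mu]_(_ in _) _.
  rewrite !ler_norml; lra.
by move=> a b; have [/main|/main/esym|->] := ltgtP a b.
Unshelve. all: by end_near. Qed.

End DuBoisReymond.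

(** * Riemann-Stieltjes integrals of continuous functions *)

Section IncrementBound.
Context {R : realType}.
Notation mu := (@lebesgue_measure R).
Implicit Types (g v : R -> R) (a b : R).

(** All that the Riemann-Stieltjes estimates use of bounded variation: the
    increments of [g] are dominated by those of a function [v], whose increments
    telescope along a partition. *)
Definition increment_bound a b g v := forall x y, a <= x -> x <= y -> y <= b ->
  `|g y - g x| <= v y - v x.

Lemma bounded_variation_increment_bound a b g : bounded_variation a b g ->
  exists v, increment_bound a b g v.
Proof.
move=> bvg; exists (fun x => fine (total_variation a x g)) => x y ax xy yb.
have bvy : bounded_variation a y g.
  exact: (bounded_variationl (le_trans ax xy) yb bvg).
have fx : total_variation a x g \is a fin_num.
  by apply/bounded_variationP => //; exact: (bounded_variationl ax xy bvy).
have fxy : total_variation x y g \is a fin_num.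
  by apply/bounded_variationP => //; exact: (bounded_variationr ax xy bvy).
rewrite (total_variationD g ax xy) fineD// addrAC subrr add0r.
by rewrite -lee_fin fineK//; exact: total_variation_ge.
Qed.

Lemma increment_bound_le a b g v : a <= b -> increment_bound a b g v ->
  v a <= v b.
Proof.
move=> ab /(_ a b (lexx _) ab (lexx _)) gab.
by rewrite -subr_ge0 (le_trans _ gab).
Qed.

Lemma increment_boundW a b a' b' g v : a <= a' -> b' <= b ->
  increment_bound a b g v -> increment_bound a' b' g v.
Proof.
by move=> aa bb gv x y ax xy yb; apply: gv => //; [exact: le_trans ax|exact: le_trans bb].
Qed.

(** Both [v] and [v - g] are nondecreasing on the segment, so [g] is a
    difference of monotone functions. *)
Lemma increment_bound_measurable a b g v : increment_bound a b g v ->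
  measurable_fun `[a, b] g.
Proof.
move=> gv.
have [ab|ba] := leP a b; last first.
  by rewrite set_itv_ge ?bnd_simp -?ltNge//; exact: measurable_fun_set0.
pose c (x : R) := Num.max a (Num.min x b).
have ac x : a <= c x by rewrite le_max lexx.
have cb x : c x <= b by rewrite ge_max ab ge_min lexx orbT.
have ccE x : a <= x <= b -> c x = x.
  by move=> /andP[ax xb]; rewrite /c min_l// max_r.
have cmono : {homo c : x y / x <= y}.
  move=> x y xy; rewrite /c ge_max le_max lexx/= le_max le_min !ge_min lexx.
  by rewrite xy orbT orbT.
apply: (eq_measurable_fun (fun x => v (c x) - (v (c x) - g (c x)))).
  by move=> x; rewrite inE/= in_itv/= => /ccE ->; rewrite subKr.
apply: measurable_funB; apply: nondecreasing_measurable => // x y /cmono cxy.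
- by have := gv _ _ (ac x) cxy (cb y); have := normr_ge0 (g (c y) - g (c x)); lra.
- by have := gv _ _ (ac x) cxy (cb y); have := ler_norm (g (c y) - g (c x)); lra.
Qed.

Lemma increment_bound_bounded a b g v x : increment_bound a b g v ->
  a <= x <= b -> `|g x| <= `|g a| + (v b - v a).
Proof.
move=> gv /andP[ax xb].
have := gv _ _ (lexx a) ax xb; have := gv _ _ ax xb (lexx b).
have := normr_ge0 (g b - g x); have := ler_normD (g x - g a) (g a).
by rewrite subrK; lra.
Qed.

Lemma increment_bound_integrableM a b g v (f : R -> R) : increment_bound a b g v ->
  continuous f -> mu.-integrable `[a, b] (EFin \o (fun x => f x * g x)).
Proof.
move=> gv cf; have [M M0 fM] := continuous_bounded_itv a b cf.
apply: (@bounded_itv_integrable _ _ _ _ (M * (`|g a| + (v b - v a)))).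
  apply: measurable_funM; last exact: increment_bound_measurable gv.
  by apply: measurable_funS (continuous_measurable_fun cf).
move=> x xab; rewrite normrM ler_pM//; first exact: fM.
exact: increment_bound_bounded gv xab.
Qed.

End IncrementBound.

Section RiemannStieltjesContinuous.
Context {R : realType}.
Notation mu := (@lebesgue_measure R).
Implicit Types (F g v phi Phi : R -> R) (a b c x y d e w M : R) (s t : seq R).

Lemma RS_sum_cons a F g x s x0 t :
  RS_sum a F g (x :: s) (x0 :: t) = F x0 * (g x - g a) + RS_sum x F g s t.
Proof. by rewrite /RS_sum big_ord_recl. Qed.

Lemma tagged_cons a x s x0 t : Defs.tagged a (x :: s) (x0 :: t) <->
  a <= x0 <= x /\ Defs.tagged x s t.
Proof.
split=> [[[st] h]|[x0x [st h]]].
  split; first exact: (h 0%N).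
  by split=> // i si; exact: (h i.+1).
by split; [rewrite /= st|case=> [//|i] /= si; exact: h].
Qed.

Lemma mesh_lt_cons a x s d : mesh_lt a (x :: s) d <->
  x - a < d /\ mesh_lt x s d.
Proof.
split=> [h|[xad h]]; last by case=> [//|i] /= si; exact: h.
by split=> [|i si]; [exact: (h 0%N)|exact: (h i.+1)].
Qed.

Lemma itv_partition_cons_lt a b x s : itv_partition a b (x :: s) ->
  [/\ a < x, x <= b & itv_partition x b s].
Proof.
move=> /[dup] /itv_partition_cons xbs [/= /andP[ax _] _].
by split => //; exact: itv_partition_le xbs.
Qed.

Lemma exists_fine_partition a b d : a <= b -> 0 < d ->
  exists s t, [/\ itv_partition a b s, Defs.tagged a s t & mesh_lt a s d].
Proof.
move=> ab d0; have d20 : 0 < d / 2 by rewrite divr_gt0.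
have [n] : exists n : nat, b - a <= n%:R * (d / 2).
  exists (Num.bound ((b - a) / (d / 2))); rewrite -ler_pdivrMr//.
  by apply/ltW/archi_boundP; rewrite divr_ge0 ?subr_ge0// ltW.
elim: n => [|n IHn] in a ab *.
  rewrite mul0r subr_le0 => ba; have -> : a = b by apply/eqP; rewrite eq_le ab.
  by exists [::], [::]; split => //; split.
have [bad _|dba] := ltP (b - a) d.
  move: ab; rewrite le_eqVlt => /predU1P[->|ab].
    by exists [::], [::]; split => //; split.
  exists [:: b], [:: b]; split; first exact: itv_partition1.
    by split=> // -[|//] _; rewrite /= lexx ltW.
  by move=> -[|//].
rewrite -natr1 mulrDl mul1r => abn.
have [||s [t [abs ast ms]]] := IHn (a + d / 2); [lra|lra|].
exists (a + d / 2 :: s), (a :: t); split.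
- by split; [rewrite /= ltrDl d20; case: abs|case: abs].
- by apply/tagged_cons; split => //; rewrite lexx lerDl ltW.
- by apply/mesh_lt_cons; split => //; lra.
Qed.

Lemma RS_sum_dist a b F F' g v e s t : increment_bound a b g v ->
  itv_partition a b s -> Defs.tagged a s t ->
  (forall x, a <= x <= b -> `|F x - F' x| <= e) ->
  `|RS_sum a F g s t - RS_sum a F' g s t| <= e * (v b - v a).
Proof.
elim: s t a => [|x s IHs] t a gv.
  by move=> /itv_partition_nil -> _ _; rewrite /RS_sum !big_ord0 !subrr normr0 mulr0.
case: t => [|x0 t]; first by move=> _ [].
move=> /itv_partition_cons_lt[ax xb xbs] /tagged_cons[/andP[ax0 x0x] xst] FF'.
have gx : `|F x0 * (g x - g a) - F' x0 * (g x - g a)| <= e * (v x - v a).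
  rewrite -mulrBl normrM ler_pM//; last exact: gv (lexx a) (ltW ax) xb.
  by apply: FF'; rewrite ax0 (le_trans x0x).
have FF'x y : x <= y <= b -> `|F y - F' y| <= e.
  by move=> /andP[xy yb]; apply: FF'; rewrite yb andbT (le_trans (ltW ax)).
have := IHs t x (increment_boundW (ltW ax) (lexx b) gv) xbs xst FF'x.
rewrite !RS_sum_cons opprD addrACA => IH.
apply: (le_trans (ler_normD _ _)).
by apply: (le_trans (lerD gx IH)); lra.
Qed.

(** Integration by parts on one cell. Splitting the cell at the tag, the error
    is the integral of [phi * (g - g x)] on the right part plus that of
    [phi * (g - g a)] on the left part, and the increments of [g] inside the
    cell are at most [v x - v a]. *)
Lemma RS_cell_C1 a x x0 Phi phi g v M :
  increment_bound a x g v -> a <= x0 <= x ->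
  continuous phi -> (forall y, is_derive y 1 Phi (phi y)) ->
  (forall y, a <= y <= x -> `|phi y| <= M) ->
  `|Phi x0 * (g x - g a) -
    (Phi x * g x - Phi a * g a - \int[mu]_(y in `[a, x]) (phi y * g y))|
    <= (x - a) * M * (v x - v a).
Proof.
move=> gv /andP[ax0 x0x] cphi dPhi phiM.
have part p q c : a <= p -> p <= q -> q <= x ->
    (forall y, p <= y <= q -> `|g y - g c| <= v x - v a) ->
    `|\int[mu]_(y in `[p, q]) (phi y * g y) - g c * (Phi q - Phi p)|
      <= M * (v x - v a) * (q - p).
  move=> ap pq qx gc.
  have gv' := increment_boundW ap qx gv.
  have ig := increment_bound_integrableM gv' cphi.
  have iphi := @continuous_itv_integrable R phi p q cphi.
  have igphi : mu.-integrable `[p, q] (EFin \o (fun y => g c * phi y)).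
    apply: continuous_itv_integrable => y.
    by apply: cvgM; [exact: cvg_cst|exact: cphi].
  rewrite -(Rintegral_is_derive pq cphi dPhi) -RintegralZl// -RintegralB//.
  apply: norm_Rintegral_itv_le => //.
    exact: itv_integrableB.
  move=> y /andP[py yq].
  rewrite (_ : _ - _ = phi y * (g y - g c)); last by ring.
  rewrite normrM ler_pM//; first by apply: phiM; rewrite (le_trans ap)// (le_trans yq).
  by apply: gc; rewrite py.
have vmono p q : a <= p -> p <= q -> q <= x -> v p <= v q.
  by move=> ap pq qx; exact: (increment_bound_le pq (increment_boundW ap qx gv)).
have h1 : `|\int[mu]_(y in `[a, x0]) (phi y * g y) - g a * (Phi x0 - Phi a)|
      <= M * (v x - v a) * (x0 - a).
  apply: part => // y /andP[ay yx0].
  have yx := le_trans yx0 x0x.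
  by have := gv a y (lexx a) ay yx; have := vmono y x ay yx (lexx x); lra.
have h2 : `|\int[mu]_(y in `[x0, x]) (phi y * g y) - g x * (Phi x - Phi x0)|
      <= M * (v x - v a) * (x - x0).
  apply: part => // y /andP[x0y yx].
  have ay := le_trans ax0 x0y.
  by have := gv y x ay yx (lexx x); have := vmono a y (lexx a) ay yx; rewrite distrC; lra.
rewrite (@Rintegral_itv_chasles _ _ a x0 x) ?ax0//; last first.
  exact: increment_bound_integrableM gv cphi.
move: h1 h2; set I1 := \int[mu]_(_ in _) _; set I2 := \int[mu]_(_ in _) _ => h1 h2.
rewrite (_ : _ - _ = (I1 - g a * (Phi x0 - Phi a)) +
  (I2 - g x * (Phi x - Phi x0))); last by ring.
rewrite (le_trans (ler_normD _ _))// (le_trans (lerD h1 h2))//.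
by lra.
Qed.

Lemma RS_sum_C1 a b Phi phi g v M d s t :
  increment_bound a b g v -> continuous phi ->
  (forall y, is_derive y 1 Phi (phi y)) ->
  (forall y, a <= y <= b -> `|phi y| <= M) ->
  itv_partition a b s -> Defs.tagged a s t -> mesh_lt a s d ->
  `|RS_sum a Phi g s t -
    (Phi b * g b - Phi a * g a - \int[mu]_(y in `[a, b]) (phi y * g y))|
    <= d * M * (v b - v a).
Proof.
move=> + cphi dPhi.
elim: s t a => [|x s IHs] t a gv phiM.
  move=> /itv_partition_nil -> _ _; rewrite /RS_sum !big_ord0 set_itv1.
  by rewrite Rintegral_set1 !subrr normr0 mulr0.
case: t => [|x0 t]; first by move=> _ [].
move=> /itv_partition_cons_lt[ax xb xbs] /tagged_cons[ax0x xst].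
move=> /mesh_lt_cons[xad mxs].
have gvx := increment_boundW (ltW ax) (lexx b) gv.
have gva := increment_boundW (lexx a) xb gv.
have M0 : 0 <= M by apply: le_trans (phiM b _); rewrite ?lexx ?(le_trans (ltW ax)).
have phiMx y : x <= y <= b -> `|phi y| <= M.
  by move=> /andP[xy yb]; apply: phiM; rewrite yb andbT (le_trans (ltW ax)).
have phiMa y : a <= y <= x -> `|phi y| <= M.
  by move=> /andP[ay yx]; apply: phiM; rewrite ay (le_trans yx).
have IH := IHs t x gvx phiMx xbs xst mxs.
have cell := RS_cell_C1 gva ax0x cphi dPhi phiMa.
rewrite RS_sum_cons (@Rintegral_itv_chasles _ _ a x b) ?(ltW ax)//; last first.
  exact: increment_bound_integrableM gv cphi.
move: IH cell; set I1 := \int[mu]_(_ in _) _; set I2 := \int[mu]_(_ in _) _.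
set S := RS_sum _ _ _ _ _ => IH cell.
rewrite (_ : _ - _ = (Phi x0 * (g x - g a) - (Phi x * g x - Phi a * g a - I2)) +
  (S - (Phi b * g b - Phi x * g x - I1))); last by ring.
rewrite (le_trans (ler_normD _ _))//.
rewrite (_ : d * M * (v b - v a) =
  d * M * (v x - v a) + d * M * (v b - v x)); last by ring.
apply: lerD => //; apply: (le_trans cell).
rewrite ler_wpM2r ?subr_ge0 ?(increment_bound_le (ltW ax) gva)//.
by rewrite ler_wpM2r// ltW.
Qed.

Lemma is_RS_integral_C1 a b Phi phi g v : a <= b ->
  increment_bound a b g v -> continuous phi ->
  (forall y, is_derive y 1 Phi (phi y)) ->
  is_RS_integral a b Phi g
    (Phi b * g b - Phi a * g a - \int[mu]_(y in `[a, b]) (phi y * g y)).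
Proof.
move=> ab gv cphi dPhi e e0.
have [M M0 phiM] := continuous_bounded_itv a b cphi.
have V0 : 0 <= v b - v a by rewrite subr_ge0 (increment_bound_le ab gv).
have K0 : 0 < M * (v b - v a) + 1 by rewrite ltr_wpDl// mulr_ge0// ltW.
exists (e / (M * (v b - v a) + 1)); first by rewrite divr_gt0.
move=> s t abs ast ms.
apply: (le_lt_trans (RS_sum_C1 gv cphi dPhi phiM abs ast ms)).
by rewrite -mulrA mulrAC ltr_pdivrMr// ltr_pM2l// ltrDl.
Qed.

(** Comparing the sums of [F] and [F'] along one common fine partition; with
    [e = 0] this is the uniqueness of the integral. *)
Lemma is_RS_integral_dist a b F F' g v w w' e : a <= b ->
  increment_bound a b g v ->
  is_RS_integral a b F g w -> is_RS_integral a b F' g w' ->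
  (forall x, a <= x <= b -> `|F x - F' x| <= e) ->
  `|w - w'| <= e * (v b - v a).
Proof.
move=> ab gv Fw Fw' FF'; apply/ler_addgt0Pr => h h0.
have h20 : 0 < h / 2 by rewrite divr_gt0.
have [d d0 hd] := Fw (h / 2) h20; have [d' d'0 hd'] := Fw' (h / 2) h20.
have [|s [t [abs ast ms]]] := @exists_fine_partition a b (Num.min d d') ab.
  by rewrite lt_min d0.
have m1 : mesh_lt a s d.
  by move=> i si; rewrite (lt_le_trans (ms i si))// ge_min lexx.
have m2 : mesh_lt a s d'.
  by move=> i si; rewrite (lt_le_trans (ms i si))// ge_min lexx orbT.
have h1 := hd s t abs ast m1; have h2 := hd' s t abs ast m2.
have h3 := RS_sum_dist gv abs ast FF'.
move: h1 h2 h3; set S := RS_sum _ _ _ _ _; set S' := RS_sum _ _ _ _ _ => h1 h2 h3.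
have := ler_distD S w w'; have := ler_distD S' S w'; rewrite (distrC w S); lra.
Qed.

Lemma RS_integral_unique a b F g v w : a <= b -> increment_bound a b g v ->
  is_RS_integral a b F g w -> RS_integral a b F g = w.
Proof.
move=> ab gv Fw; apply: xget_unique => // w' Fw'; apply/eqP.
have := is_RS_integral_dist (e := 0) ab gv Fw' Fw.
rewrite mul0r normr_le0 subr_eq0; apply.
by move=> x _; rewrite subrr normr0.
Qed.

(** Averages of [F] over short intervals. *)
Lemma C1_approximation a b F e : continuous F -> 0 < e ->
  exists Phi phi, [/\ continuous phi, forall x, is_derive x 1 Phi (phi x) &
    forall x, a <= x <= b -> `|F x - Phi x| <= e].
Proof.
move=> cF e0; have [G dG] := continuous_antiderivative cF.
have [d d0 hd] := continuous_uniform_itv a b cF e0.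
pose h := d / 2; have h0 : 0 < h by rewrite divr_gt0.
exists (fun x => h^-1 * (G (x + h) - G x)), (fun x => h^-1 * (F (x + h) - F x)).
split.
- move=> x; apply: cvgM; first exact: cvg_cst.
  apply: cvgB; last exact: cF.
  apply: (@cvg_comp _ _ _ (fun x => x + h) F); last exact: cF.
  by apply: cvgD; [exact: cvg_id|exact: cvg_cst].
- move=> x.
  have dGh : is_derive x 1 (fun y => G (y + h)) (F (x + h)).
    exact: is_derive_comp_shift.
  exact: is_deriveZ.
- move=> x xab; rewrite distrC; apply: mean_dist => //; first by rewrite gt_eqF.
  move=> y yx; apply/ltW/hd => //; rewrite (le_lt_trans yx)// gtr0_norm//.
  by rewrite /h; lra.
Qed.

(** C1 functions have a Riemann-Stieltjes integral by integration by parts. If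
    [Phi] is C1 and within [e] of [F], then the integral of [F] has to lie
    within [e * V] of that of [Phi], where [V] bounds the variation of [g].
    Two such intervals always meet, so the supremum of their left ends lies in
    all of them. This needs no common refinement of partitions. *)
Lemma is_RS_integral_continuous a b F g v : a <= b ->
  increment_bound a b g v -> continuous F ->
  exists w, is_RS_integral a b F g w.
Proof.
move=> ab gv cF.
set V := v b - v a; have V0 : 0 <= V by rewrite subr_ge0 (increment_bound_le ab gv).
pose L Phi phi := Phi b * g b - Phi a * g a - \int[mu]_(y in `[a, b]) (phi y * g y).
pose close e Phi phi := [/\ continuous phi,
  forall x, is_derive x 1 Phi (phi x) & forall x, a <= x <= b -> `|F x - Phi x| <= e].
pose S := [set r | exists e Phi phi, close e Phi phi /\ r = L Phi phi - e * V].
have Sub e Phi phi : close e Phi phi -> ubound S (L Phi phi + e * V).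
  move=> [cphi dPhi FPhi] _ [e' [Psi [psi [[cpsi dPsi FPsi] ->]]]].
  have h := is_RS_integral_dist ab gv (is_RS_integral_C1 ab gv cpsi dPsi)
    (is_RS_integral_C1 ab gv cphi dPhi) (e := e' + e).
  have {h}/h : forall x, a <= x <= b -> `|Psi x - Phi x| <= e' + e.
    move=> x xab; have := ler_distD (F x) (Psi x) (Phi x).
    by have := FPhi x xab; have := FPsi x xab; rewrite (distrC (F x) (Psi x)); lra.
  by rewrite ler_norml -/(L Phi phi) -/(L Psi psi) -/V mulrDl; lra.
have closeP e : 0 < e -> exists Phi phi, close e Phi phi by exact: C1_approximation.
have S0 : S !=set0.
  have [Phi [phi c]] := closeP 1 ltr01.
  by exists (L Phi phi - 1 * V), 1, Phi, phi.
exists (sup S) => h h0.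
pose e := h / (3 * (V + 1)).
have V1 : 0 < V + 1 by rewrite ltr_wpDl.
have e0 : 0 < e by rewrite divr_gt0// mulr_gt0.
have eV : e * V < h / 3.
  rewrite /e mulrAC ltr_pdivrMr ?mulr_gt0//.
  rewrite (_ : h / 3 * (3 * (V + 1)) = h * (V + 1)); last by field.
  by rewrite ltr_pM2l// ltrDl.
have [Phi [phi c]] := closeP e e0.
have [cphi dPhi FPhi] := c.
have up : sup S <= L Phi phi + e * V by apply: ge_sup => //; exact: Sub c.
have lo : L Phi phi - e * V <= sup S.
  by apply: ub_le_sup; [exists (L Phi phi + e * V); exact: Sub c|exists e, Phi, phi].
have h30 : 0 < h / 3 by rewrite divr_gt0.
have [d d0 hd] := is_RS_integral_C1 ab gv cphi dPhi h30.
exists d => // s t abs ast ms.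
have h1 := hd s t abs ast ms.
have h2 := RS_sum_dist gv abs ast FPhi.
rewrite -/(L Phi phi) in h1; rewrite -/V in h2.
move: h1 h2; set A := RS_sum _ _ _ _ _; set B := RS_sum _ _ _ _ _.
rewrite !ltr_norml !ler_norml; lra.
Qed.

End RiemannStieltjesContinuous.

(** * Distributions defined by continuous functions *)

Section RegularDistributions.
Context {R : realType}.
Notation mu := (@lebesgue_measure R).
Implicit Types (F G c W h : R -> R) (phi psi : test_fun R) (a b x y A : R).

Lemma test_smooth phi : smooth phi.
Proof. by case: phi => phi /= /asboolP[]. Qed.

Lemma test_continuous phi : continuous phi.
Proof. exact/smooth_continuous/test_smooth. Qed.

Lemma compact_in_itv (K : set R) : compact K ->
  exists2 A, 0 < A & forall x, K x -> - A < x < A.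
Proof.
move=> /compact_bounded[M [_ KM]]; exists (`|M| + 2).
  by rewrite ltr_wpDl.
move=> x Kx; rewrite -ltr_norml (@le_lt_trans _ _ (`|M| + 1))//; last by lra.
by apply: KM => //; rewrite (le_lt_trans (ler_norm M))// ltrDl.
Qed.

Lemma test_support phi : exists2 A, 0 < A &
  forall x, ~~ (- A < x < A) -> phi x = 0.
Proof.
have : compact (supp phi) by case: phi => phi /= /asboolP[].
move=> /compact_in_itv[A A0 KA]; exists A => // x xA.
by apply: supp0 => /KA; exact/negP.
Qed.

Lemma test_support2 phi psi : exists2 A, 0 < A &
  forall x, ~~ (- A < x < A) -> phi x = 0 /\ psi x = 0.
Proof.
have [A A0 phi0] := test_support phi; have [B B0 psi0] := test_support psi.
exists (Num.max A B) => [|x xC]; first by rewrite lt_max A0.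
have sub D : D <= Num.max A B -> ~~ (- D < x < D).
  move=> DC; apply: contra xC => /andP[xD Dx].
  by rewrite (le_lt_trans _ xD) ?lerN2// (lt_le_trans Dx).
by rewrite phi0 ?psi0//; apply: sub; rewrite le_max lexx ?orbT.
Qed.

Lemma Rintegral_open_support F A : (forall x, ~~ (- A < x < A) -> F x = 0) ->
  \int[mu]_x F x = \int[mu]_(x in `[- A, A]) F x.
Proof.
move=> F0; apply: Rintegral_support => x xA; apply: F0.
by apply: contra xA => /andP[ax xb]; rewrite !ltW.
Qed.

Lemma continuous_mul_test c phi : continuous c ->
  continuous (fun x => c x * phi x).
Proof. by move=> cc x; apply: cvgM; [exact: cc|exact: test_continuous]. Qed.

(** Integration by parts on a segment at whose ends the test function is [0]. *)
Lemma regular_distr_derive c W : continuous c ->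
  (forall x, is_derive x 1 W (c x)) ->
  regular_distr c = distr_deriv (regular_distr W).
Proof.
move=> cc dW; apply/funext => phi.
have cW := is_derive_continuous dW.
have [B B0 Bsupp] := test_support2 phi (test_deriv phi).
rewrite /distr_deriv /regular_distr.
rewrite (@Rintegral_open_support _ B); last first.
  by move=> x /Bsupp[-> _]; rewrite mulr0.
rewrite (@Rintegral_open_support (fun x => W x * _) B); last first.
  by move=> x /Bsupp[_ ->]; rewrite mulr0.
have dphi x := smooth_is_derive x (@test_smooth phi).
have dM x : is_derive x 1 (fun y => W y * phi y)
    (c x * phi x + W x * test_deriv phi x).
  have := is_deriveM (dW x) (dphi x).
  by rewrite /GRing.scale/= addrC [phi x * _]mulrC.
have c1 := continuous_mul_test (phi := phi) cc.
have c2 := continuous_mul_test (phi := test_deriv phi) cW.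
have c3 : continuous (fun x => c x * phi x + W x * test_deriv phi x).
  by move=> x; apply: cvgD; [exact: c1|exact: c2].
have BB : - B <= B by lra.
have := Rintegral_is_derive BB c3 dM.
rewrite RintegralD//; [|exact: continuous_itv_integrable..].
have [|-> _] := Bsupp B; first by rewrite ltxx andbF.
have [|-> _] := Bsupp (- B); first by rewrite ltxx.
by rewrite !mulr0 subrr => /eqP; rewrite addr_eq0 => /eqP.
Qed.

Lemma regular_distr_scalar c : continuous c -> scalar (regular_distr c).
Proof.
move=> cc k phi psi.
have [B B0 Bsupp] := test_support2 phi psi.
rewrite /regular_distr !(@Rintegral_open_support _ B).
- have i1 : mu.-integrable `[- B, B] (EFin \o (fun x => c x * phi x)).
    by apply: continuous_itv_integrable; exact: continuous_mul_test.
  have i2 : mu.-integrable `[- B, B] (EFin \o (fun x => c x * psi x)).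
    by apply: continuous_itv_integrable; exact: continuous_mul_test.
  have i3 : mu.-integrable `[- B, B] (EFin \o (fun x => k * (c x * phi x))).
    apply: continuous_itv_integrable => x; apply: cvgM; first exact: cvg_cst.
    exact: continuous_mul_test.
  rewrite /GRing.scale/= -RintegralZl// -RintegralD//.
  apply: eq_Rintegral => x _.
  by transitivity (c x * (k * phi x + psi x)) => //; ring.
- by move=> x /Bsupp[_ ->]; rewrite mulr0.
- by move=> x /Bsupp[-> _]; rewrite mulr0.
- move=> x /Bsupp[p0 q0]; transitivity (c x * (k * phi x + psi x)) => //.
  by rewrite p0 q0 mulr0 addr0 mulr0.
Qed.


Lemma regular_distr_continuous c (u : nat -> test_fun R) phi :
  continuous c -> cvg_test u phi ->
  regular_distr c (u n) @[n --> \oo] --> regular_distr c phi.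
Proof.
move=> cc [[K cK uK] ucvg].
have [A A0 KA] := compact_in_itv cK.
have [A' A'0 phi0] := test_support phi.
pose B := Num.max A A'.
have AB : A <= B by rewrite le_max lexx.
have A'B : A' <= B by rewrite le_max lexx orbT.
have B0 : 0 < B by rewrite lt_max A0.
have u0 n x : ~~ (- B < x < B) -> u n x = 0.
  move=> xB; apply: supp0 => /uK/KA /andP[xA Ax]; move: xB.
  by rewrite (lt_le_trans Ax)// (le_lt_trans _ xA)// lerN2.
have {}phi0 x : ~~ (- B < x < B) -> phi x = 0.
  move=> xB; apply: phi0; apply: contra xB => /andP[xA Ax].
  by rewrite (lt_le_trans Ax)// (le_lt_trans _ xA)// lerN2.
have [M M0 cM] := continuous_bounded_itv (- B) B cc.
apply/cvgrPdist_le => e e0.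
have K0 : 0 < M * (B - - B) by rewrite mulr_gt0//; lra.
have := ucvg 0%N (e / (M * (B - - B))) (divr_gt0 e0 K0).
apply: filterS => n hn.
have i1 : mu.-integrable `[- B, B] (EFin \o (fun x => c x * phi x)).
  by apply: continuous_itv_integrable; exact: continuous_mul_test.
have i2 : mu.-integrable `[- B, B] (EFin \o (fun x => c x * u n x)).
  by apply: continuous_itv_integrable; exact: continuous_mul_test.
rewrite /regular_distr !(@Rintegral_open_support _ B); last 2 first.
- by move=> x /u0 ->; rewrite mulr0.
- by move=> x /phi0 ->; rewrite mulr0.
rewrite -RintegralB//.
have -> : e = M * (e / (M * (B - - B))) * (B - - B).
  by field; rewrite !gt_eqF//; lra.
apply: norm_Rintegral_itv_le; first by lra.
  exact: itv_integrableB.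
move=> x xB; rewrite -mulrBr normrM ler_pM//; first exact: cM.
by rewrite distrC ltW//; have := hn x.
Qed.

Lemma distribution_regular c : continuous c -> Defs.distribution (regular_distr c).
Proof.
move=> cc; split; first exact: regular_distr_scalar.
by move=> u phi; exact: regular_distr_continuous.
Qed.

Lemma distributionB (S T : test_fun R -> R) :
  Defs.distribution S -> Defs.distribution T -> Defs.distribution (S - T).
Proof.
move=> [linS cS] [linT cT]; split=> [k phi psi|u phi uphi].
  by rewrite !fctE linS linT /GRing.scale/=; ring.
by apply: cvgB; [exact: cS|exact: cT].
Qed.

Lemma distr_derivB F G : continuous F -> continuous G ->
  distr_deriv (regular_distr F) - distr_deriv (regular_distr G) =
  distr_deriv (regular_distr (fun x => F x - G x)).
Proof.
move=> cF cG; apply/funext => phi.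
rewrite -[LHS]/(distr_deriv (regular_distr F) phi - distr_deriv (regular_distr G) phi).
rewrite /distr_deriv /regular_distr.
have [B B0 phi0] := test_support (test_deriv phi).
rewrite !(@Rintegral_open_support _ B); try by move=> x /phi0 ->; rewrite mulr0.
rewrite -opprD -RintegralB//.
- by congr (- _); apply: eq_Rintegral => x _; rewrite mulrBl.
- by apply: continuous_itv_integrable; exact: continuous_mul_test.
- by apply: continuous_itv_integrable; exact: continuous_mul_test.
Qed.

Lemma continuous_locally_integrable c : continuous c -> locally_integrable setT c.
Proof.
move=> cc; split=> [||K _ cK]; [exact: continuous_measurable_fun|exact: openT|].
have := @continuous_compact_integrable R c K cK (continuous_subspaceT cc).
by move=> /integrableP[_].
Qed.

(** If [H] is an antiderivative of [h], then [s |-> - H (x - s)] is one of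
    [s |-> h (x - s)], so both sides are [H b - H a]. *)
Lemma Rintegral_refl h a b x : a <= b -> continuous h ->
  (forall y, ~~ (a <= y <= b) -> h y = 0) ->
  \int[mu]_s h (x - s) = \int[mu]_s h s.
Proof.
move=> ab ch h0; have [H dH] := continuous_antiderivative ch.
rewrite (@Rintegral_support _ h a b)// (Rintegral_is_derive ab ch dH).
rewrite (@Rintegral_support _ _ (x - b) (x - a)); last first.
  by move=> s sab; apply: h0; apply: contra sab; lra.
have dHx (s : R) : is_derive s 1 (fun s => - H (x - s)) (h (x - s)).
  by rewrite -[h _]opprK; apply: is_deriveN; exact: is_derive_comp_refl.
have chx := continuous_comp_refl (x := x) ch.
have xba : x - b <= x - a by lra.
by rewrite (Rintegral_is_derive xba chx dHx) !subKr; ring.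
Qed.

(** The two candidates differ by a constant, and they agree at [- pi]. *)
Lemma primitive_unique (f : test_fun R -> R) F G :
  is_primitive f F -> is_primitive f G -> F = G.
Proof.
move=> [[cF F0 _] fF] [[cG G0 _] fG].
have cFG : continuous (fun x => F x - G x).
  by move=> x; apply: cvgB; [exact: cF|exact: cG].
have FG0 phi : \int[mu]_x ((F x - G x) * derive1 phi x) = 0.
  have := congr1 (fun T => T phi) (distr_derivB cF cG).
  by rewrite -fF -fG subrr => /esym/eqP; rewrite /distr_deriv oppr_eq0 => /eqP.
apply/funext => x; have := du_bois_reymond cFG FG0 x (- pi).
by rewrite F0 G0 subrr => /eqP; rewrite subr_eq0 => /eqP.
Qed.

Lemma primitiveE (f : test_fun R -> R) F : is_primitive f F -> primitive f = F.
Proof. by move=> fF; apply: xget_unique => // G fG; exact: primitive_unique fG fF. Qed.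

End RegularDistributions.

(** * Primitives that are periodic up to a linear term *)

Section QuasiPeriodic.
Context {R : realType}.
Notation mu := (@lebesgue_measure R).
Implicit Types (F g : R -> R) (x y t d e K : R) (n : int).

Lemma period_reduction x :
  exists y n, - pi <= y < pi /\ x = y + 2 * n%:~R * pi :> R.
Proof.
have p0 : 0 < 2 * pi :> R by rewrite mulr_gt0// pi_gt0.
pose n := Num.floor ((x + pi) / (2 * pi)).
exists (x - 2 * n%:~R * pi), n; split; last by rewrite subrK.
have /andP[] := floor_itv ((x + pi) / (2 * pi)).
rewrite -/n ler_pdivlMr// ltr_pdivrMr// intrD => h1 h2; apply/andP; split; lra.
Qed.

Lemma B_c_shift F x n : B_c F -> F (x + 2 * n%:~R * pi) = F x + n%:~R * F pi.
Proof.
move=> [_ _ Fper]; have [y [m [ypi ->]]] := period_reduction x.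
rewrite (Fper _ m ypi) (_ : _ + _ + _ = y + 2 * (m + n)%:~R * pi); last first.
  by rewrite intrD; ring.
by rewrite Fper// intrD; ring.
Qed.

(** Translating both points by the same multiple of the period does not change
    the increments of [F], so that one period decides. *)
Lemma B_c_uniform F e : B_c F -> 0 < e ->
  exists2 d, 0 < d & forall x y, `|y - x| < d -> `|F y - F x| < e.
Proof.
move=> BF e0; have [cF _ _] := BF.
have [d d0 hd] := continuous_uniform_itv (- pi) pi cF e0.
exists d => // x y; have [x' [n [/andP[x1 x2] ->]]] := period_reduction x.
have -> : y = (y - 2 * n%:~R * pi) + 2 * n%:~R * pi by rewrite subrK.
move: (y - _) => y'; rewrite (B_c_shift x' n BF) (B_c_shift y' n BF).
have -> : y' + 2 * n%:~R * pi - (x' + 2 * n%:~R * pi) = y' - x' by ring.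
have -> : F y' + n%:~R * F pi - (F x' + n%:~R * F pi) = F y' - F x' by ring.
by apply: hd; rewrite x1 ltW.
Qed.

Lemma B_c_increment_bounded F : B_c F ->
  exists2 K, 0 < K & forall x t, `|t| <= pi -> `|F (x - t) - F x| <= K.
Proof.
move=> BF; have [cF _ _] := BF; have p0 := pi_gt0 R.
have [M M0 FM] := continuous_bounded_itv (- (2 * pi)) (2 * pi) cF.
exists (M + M) => [|x t]; first lra.
rewrite ler_norml => /andP[t1 t2].
have [x' [n [/andP[x1 x2] ->]]] := period_reduction x.
rewrite addrAC (B_c_shift x' n BF) (B_c_shift (x' - t) n BF) opprD addrACA subrr addr0.
rewrite (le_trans (ler_normB _ _))// lerD//; apply: FM; lra.
Qed.

(** Reversing the orientation makes [t |-> - F (x - t)] a primitive of the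
    reflected distribution; the constant [F (x + pi)] normalizes it at [- pi]. *)
Lemma is_primitive_refl (f : test_fun R -> R) F x : is_primitive f F ->
  is_primitive (distr_refl x f) (fun t => F (x + pi) - F (x - t)).
Proof.
move=> [BF fF]; have [cF _ _] := BF.
have cFx := continuous_comp_refl (x := x) cF.
split.
  split.
  - by move=> t; apply: cvgB; [exact: cvg_cst|exact: cFx].
  - by rewrite opprK subrr.
  - move=> y n _; have -> : x + pi = x - pi + 2 * 1%:~R * pi by ring.
    rewrite (B_c_shift (x - pi) 1 BF).
    have -> : F (x - (y + 2 * n%:~R * pi)) = F (x - y) - n%:~R * F pi.
      rewrite [in RHS](_ : x - y = x - (y + 2 * n%:~R * pi) + 2 * n%:~R * pi); last ring.
      by rewrite (B_c_shift (x - (y + 2 * n%:~R * pi)) n BF); ring.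
    by ring.
apply/funext => phi; rewrite /distr_refl fF.
apply: (congr1 (fun r : R => - r)); rewrite /regular_distr.
have sphi := @test_smooth R phi.
have cphi := @test_continuous R (test_deriv phi).
have [A A0 phi0] := test_support2 phi (test_deriv phi).
have dE t : test_deriv (test_refl x phi) t = - test_deriv phi (x - t).
  rewrite /= (_ : derive1 _ t = derive1n 1 (fun t => phi (x - t)) t)//.
  by rewrite derive1n_refl// expr1 mulN1r.
transitivity (\int[mu]_t (- (fun s => F (x - s) * test_deriv phi s) (x - t))).
  by apply: eq_Rintegral => t _; rewrite dE subKr mulrN.
pose h s := - (F (x - s) * test_deriv phi s).
have ch : continuous h.
  by move=> s; apply: cvgN; apply: (continuous_mul_test (phi := test_deriv phi)).
have AA : - A <= A by lra.
have out y : ~~ (- A <= y <= A) -> test_deriv phi y = 0.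
  by move=> yA; have [] := phi0 y; first by apply: contra yA => /andP[/ltW-> /ltW->].
rewrite (@Rintegral_refl _ h (- A) A)//; last first.
  by move=> y /out; rewrite /h => ->; rewrite mulr0 oppr0.
rewrite (@Rintegral_support _ h (- A) A); last first.
  by move=> y /out; rewrite /h => ->; rewrite mulr0 oppr0.
rewrite (@Rintegral_support _ _ (- A) A); last first.
  by move=> y /out ->; rewrite mulr0.
have I0 : \int[mu]_(t in `[- A, A]) test_deriv phi t = 0.
  rewrite (Rintegral_is_derive AA cphi (fun t => smooth_is_derive t sphi)).
  have [|-> _] := phi0 A; first by rewrite ltxx andbF.
  by have [|-> _] := phi0 (- A); [rewrite ltxx|rewrite subrr].
transitivity (\int[mu]_(t in `[- A, A]) (F (x + pi) * test_deriv phi t + h t)); last first.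
  by apply: eq_Rintegral => t _; rewrite /h mulrBl.
rewrite RintegralD//; [|apply: continuous_itv_integrable|exact: continuous_itv_integrable].
  rewrite RintegralZl//; last exact: continuous_itv_integrable.
  by rewrite I0 mulr0 add0r.
by move=> t; apply: cvgM; [exact: cvg_cst|exact: cphi].
Qed.

End QuasiPeriodic.

(** * The primitive of a convolution *)

Section ConvolutionPrimitive.
Context {R : realType}.
Notation mu := (@lebesgue_measure R).
Implicit Types (f : test_fun R -> R) (F g v : R -> R) (x y t d e h K : R).

Definition period_conv F g x : R := \int[mu]_(t in `[- pi, pi]) (F (x - t) * g t).

Lemma leNpi_pi : - pi <= pi :> R. Proof. by have := pi_gt0 R; lra. Qed.

Lemma BV_T_integrableM F g : continuous F -> BV_T g ->
  mu.-integrable `[- pi, pi] (EFin \o (fun x => F x * g x)).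
Proof.
move=> cF [_ /bounded_variation_increment_bound[v gv]].
exact: increment_bound_integrableM gv cF.
Qed.

Lemma BV_T_integrable g : BV_T g -> mu.-integrable `[- pi, pi] (EFin \o g).
Proof.
move=> BVg; have c1 : continuous (fun _ : R => 1 : R) by move=> t; exact: cvg_cst.
have := BV_T_integrableM c1 BVg.
by under [X in EFin \o X]eq_fun do rewrite mul1r.
Qed.

Lemma periodic_end g : periodic g (2 * pi) -> g (- pi) = g pi.
Proof. by move=> /(_ (- pi)) <-; congr g; ring. Qed.

(** The convolution is the Riemann-Stieltjes integral of [t |-> F (x - t)]
    against [g]. Replacing [F] there by the C1 function
    [s |-> h^-1 * (G (s + h) - G s)], with [G] an antiderivative of [F], costs at
    most [e] times the variation of [g], and integration by parts turns the new
    integral into the difference quotient of [period_conv F g]. The term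
    [2 * `|g pi|] is the same replacement in the boundary term. *)
Lemma convolution_difference_quotient f F g v x h e : is_primitive f F ->
  periodic g (2 * pi) -> increment_bound (- pi) pi g v -> h != 0 ->
  (forall y z, `|z - y| <= `|h| -> `|F z - F y| <= e) ->
  `|h^-1 * (period_conv F g (x + h) - period_conv F g x) - convolution f g x|
    <= e * (2 * `|g pi| + (v pi - v (- pi))).
Proof.
move=> fF pg gv h0 Fe; have [[cF _ _] _] := fF.
have [G dG] := continuous_antiderivative cF.
have fFx := is_primitive_refl x fF.
rewrite /convolution /cp_integral_mul (primitiveE fFx).
pose P t := F (x + pi) - F (x - t).
have cP : continuous P by have [[]] := fFx.
have [w Pw] := is_RS_integral_continuous leNpi_pi gv cP.
rewrite -/P (RS_integral_unique leNpi_pi gv Pw).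
pose q t := h^-1 * (F (x - t + h) - F (x - t)).
pose Q t := F (x + pi) - h^-1 * (G (x - t + h) - G (x - t)).
have cFh : continuous (fun t => F (x - t + h)).
  have -> : (fun t => F (x - t + h)) = (fun t => F ((x + h) - t)).
    by apply/funext => t; rewrite addrAC.
  exact: continuous_comp_refl.
have cq : continuous q.
  move=> t; apply: cvgM; first exact: cvg_cst.
  by apply: cvgB; [exact: cFh|exact: continuous_comp_refl].
have dQ t : is_derive t 1 Q (q t).
  have d1 : is_derive t 1 (fun t => G (x - t)) (- F (x - t)) by exact: is_derive_comp_refl.
  have d2 : is_derive t 1 (fun t => G (x - t + h)) (- F (x - t + h)).
    have -> : (fun t => G (x - t + h)) = (fun t => G ((x + h) - t)).
      by apply/funext => s; rewrite addrAC.
    by rewrite addrAC; exact: is_derive_comp_refl.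
  have -> : q t = 0 - h^-1 * (- F (x - t + h) - - F (x - t)) by rewrite /q; ring.
  exact: (is_deriveB (is_derive_cst (F (x + pi)) t 1) (is_deriveZ h^-1 (is_deriveB d2 d1))).
have PQ t : `|P t - Q t| <= e.
  rewrite /P /Q (_ : _ - _ = h^-1 * (G (x - t + h) - G (x - t)) - F (x - t)); last by ring.
  by apply: mean_dist => // y; exact: Fe.
have := is_RS_integral_dist leNpi_pi gv Pw (is_RS_integral_C1 leNpi_pi gv cq dQ)
  (fun t _ => PQ t).
set V := v pi - v (- pi); rewrite (periodic_end pg).
have -> : \int[mu]_(t in `[- pi, pi]) (q t * g t) =
    h^-1 * (period_conv F g (x + h) - period_conv F g x).
  have i1 := increment_bound_integrableM gv (continuous_comp_refl (x := x + h) cF).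
  have i2 := increment_bound_integrableM gv (continuous_comp_refl (x := x) cF).
  rewrite -RintegralB// -RintegralZl//; last exact: itv_integrableB.
  by apply: eq_Rintegral => t _; rewrite /q (addrAC x (- t)) -mulrBl mulrA.
set D := h^-1 * _ => wV.
have PP : P (- pi) = 0 by rewrite /P opprK subrr.
have e1 := PQ pi; have e2 := PQ (- pi).
have e3 : `|(P pi - Q pi - (P (- pi) - Q (- pi))) * g pi| <= e * (2 * `|g pi|).
  rewrite normrM mulrA ler_wpM2r// (le_trans (ler_normB _ _))//; lra.
rewrite (_ : D - _ = (w - (Q pi * g pi - Q (- pi) * g pi - D)) -
  (P pi - Q pi - (P (- pi) - Q (- pi))) * g pi); last by rewrite PP /P; ring.
by rewrite (le_trans (ler_normB _ _))// mulrDr addrC lerD.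
Qed.

Lemma convolution_difference_quotient_uniform f F g e : is_primitive f F ->
  BV_T g -> 0 < e -> exists2 d, 0 < d & forall x h, h != 0 -> `|h| < d ->
    `|h^-1 * (period_conv F g (x + h) - period_conv F g x) - convolution f g x| <= e.
Proof.
move=> fF [pg /bounded_variation_increment_bound[v gv]] e0.
have V0 : 0 <= v pi - v (- pi) by rewrite subr_ge0 (increment_bound_le leNpi_pi gv).
pose K := 2 * `|g pi| + (v pi - v (- pi)) + 1.
have K0 : 0 < K by rewrite ltr_wpDl// addr_ge0// mulr_ge0.
have [d d0 hd] := B_c_uniform fF.1 (divr_gt0 e0 K0).
exists d => // x h h0 hdd.
apply: (le_trans (convolution_difference_quotient x fF pg gv h0 (e := e / K) _)).
  by move=> y z zy; apply/ltW/hd; exact: le_lt_trans hdd.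
by rewrite mulrAC ler_pdivrMr// ler_pM2l// lerDl.
Qed.

Lemma is_derive_period_conv f F g x : is_primitive f F -> BV_T g ->
  is_derive x 1 (period_conv F g) (convolution f g x).
Proof.
move=> fF BVg.
have cv : h^-1 *: (period_conv F g (h *: 1 + x) - period_conv F g x) @[h --> 0^'] -->
    convolution f g x.
  apply/cvgrPdist_le => e e0.
  have [d d0 hd] := convolution_difference_quotient_uniform fF BVg e0.
  near=> h; rewrite distrC /GRing.scale/= mulr1 (addrC h).
  apply: hd; first by near: h; exact: nbhs_dnbhs_neq.
  by near: h; exact: dnbhs0_lt.
by apply: DeriveDef; [apply/cvg_ex; exists (convolution f g x)|exact/cvg_lim].
Unshelve. all: by end_near. Qed.

(** A uniform limit of difference quotients of the continuous function
    [period_conv F g]. *)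
Lemma convolution_continuous f F g : is_primitive f F -> BV_T g ->
  continuous (convolution f g).
Proof.
move=> fF BVg x.
have cL : continuous (period_conv F g).
  by apply: is_derive_continuous => y; exact: is_derive_period_conv fF BVg.
apply/cvgrPdist_le => e e0; have e30 : 0 < e / 3 by rewrite divr_gt0.
have [d d0 hd] := convolution_difference_quotient_uniform fF BVg e30.
pose h := d / 2; have h0 : h != 0 by rewrite gt_eqF// divr_gt0.
have hN : `|h| < d by rewrite gtr0_norm ?divr_gt0// /h; lra.
pose q y := h^-1 * (period_conv F g (y + h) - period_conv F g y).
have cq : continuous q.
  move=> y; apply: cvgM; first exact: cvg_cst.
  apply: cvgB; last exact: cL.
  apply: (@continuous_comp _ _ _ (fun y => y + h) (period_conv F g)); last exact: cL.
  by apply: cvgD; [exact: cvg_id|exact: cvg_cst].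
have qc y : `|q y - convolution f g y| <= e / 3 by exact: hd.
near=> y.
have : `|q x - q y| <= e / 3.
  by near: y; move/cvgrPdist_le : (cq x); apply.
have := qc x; have := qc y; rewrite !ler_norml; lra.
Unshelve. all: by end_near. Qed.

Lemma period_conv_shift F g x (n : int) : B_c F -> BV_T g ->
  period_conv F g (x + 2 * n%:~R * pi) =
  period_conv F g x + n%:~R * F pi * \int[mu]_(t in `[- pi, pi]) g t.
Proof.
move=> BF BVg; have [cF _ _] := BF; have ig := BV_T_integrable BVg.
have i1 := BV_T_integrableM (continuous_comp_refl (x := x) cF) BVg.
rewrite -RintegralZl// -RintegralD//; last first.
  by apply: BV_T_integrableM BVg => t; exact: cvg_cst.
by apply: eq_Rintegral => t _; rewrite addrAC (B_c_shift _ _ BF) mulrDl.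
Qed.

(** The derivative of a function that shifting by a period changes by a constant
    is periodic. *)
Lemma convolution_periodic f F g : is_primitive f F -> BV_T g ->
  periodic (convolution f g) (2 * pi).
Proof.
move=> fF BVg x.
have d1 := is_derive_period_conv (x + 2 * pi) fF BVg.
have d2 := is_derive_comp_shift d1.
have E : (fun y => period_conv F g (y + 2 * pi)) =
    (fun y => period_conv F g y + F pi * \int[mu]_(t in `[- pi, pi]) g t).
  apply/funext => y; have := period_conv_shift y 1 fF.1 BVg.
  by rewrite mulr1 mul1r.
rewrite E in d2.
have d3 := is_deriveD (is_derive_period_conv x fF BVg)
  (is_derive_cst (F pi * \int[mu]_(t in `[- pi, pi]) g t) x 1).
by rewrite -(is_derive_derive1 d2) (is_derive_derive1 d3) addr0.
Qed.

(** [period_conv F g] has slope [F pi] times the integral of [g] per period; only for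
    kernels of integral [1] is this the slope of [F], which makes the difference
    periodic. *)
Lemma is_primitive_convolutionB f F g : Defs.distribution f -> is_primitive f F ->
  BV_T g -> \int[mu]_(t in `[- pi, pi]) g t = 1 ->
  is_primitive (regular_distr (convolution f g) - f)
    (fun x => period_conv F g x - F x - period_conv F g (- pi)).
Proof.
move=> df fF BVg g1; have [BF fE] := fF; have [cF F0 _] := BF.
have dL x := is_derive_period_conv x fF BVg.
have cL := is_derive_continuous dL.
split.
  split.
  - move=> x; apply: cvgB; last exact: cvg_cst.
    by apply: cvgB; [exact: cL|exact: cF].
  - by rewrite F0 subr0 subrr.
  - move=> y n _; rewrite period_conv_shift// g1 mulr1 (B_c_shift _ _ BF).
    have := period_conv_shift (- pi) 1 BF BVg; rewrite g1 mulr1 mul1r mulr1.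
    have -> : - pi + 2 * pi = pi :> R by ring.
    by move=> ->; ring.
pose L0 x := period_conv F g x - period_conv F g (- pi).
have dL0 x : is_derive x 1 L0 (convolution f g x).
  have := is_deriveB (dL x) (is_derive_cst (period_conv F g (- pi)) x 1).
  by rewrite subr0.
rewrite (regular_distr_derive (convolution_continuous fF BVg) dL0) [in LHS]fE.
rewrite distr_derivB//; last exact: is_derive_continuous dL0.
by congr (distr_deriv (regular_distr _)); apply/funext => x; rewrite /L0 addrAC.
Qed.

End ConvolutionPrimitive.

(** * Summability kernels *)

Section ApproximateIdentity.
Context {R : realType}.
Notation mu := (@lebesgue_measure R).
Implicit Types (f : test_fun R -> R) (F g : R -> R) (x y t d e K : R).

Lemma Rintegral_itv_oo_cc (g : R -> R) (a b : R) :
  mu.-integrable `[a, b] (EFin \o g) ->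
  \int[mu]_(x in `]a, b[) g x = \int[mu]_(x in `[a, b]) g x.
Proof.
move=> fi; rewrite (@Rintegral_itv_bndo_bndc _ (BRight a) b); last first.
  by apply: integrableS fi => //; exact: subset_itv_oo_cc.
rewrite (@Rintegral_itv_obnd_cbnd _ a (BRight b))//.
by apply: integrableS fi => //; exact: subset_itv_oc_cc.
Qed.

(** The mass of [g] near [0] only sees small increments of [F]; away from [0]
    the increments of [F] are merely bounded but [g] has little mass. *)
Lemma period_conv_sub_le F g x d e K : B_c F -> BV_T g ->
  \int[mu]_(s in `[- pi, pi]) g s = 1 -> 0 < d ->
  (forall t, `|t| <= d -> `|F (x - t) - F x| <= e) ->
  (forall t, `|t| <= pi -> `|F (x - t) - F x| <= K) ->
  `|period_conv F g x - F x| <= e * \int[mu]_(s in `[- pi, pi]) `|g s| +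
    K * \int[mu]_(s in [set s | d < `|s| < pi]) `|g s|.
Proof.
move=> BF BVg g1 d0 Fe FK; have [cF _ _] := BF.
have ig := BV_T_integrable BVg.
have iF := BV_T_integrableM (continuous_comp_refl (x := x) cF) BVg.
have c1 (k : R) : continuous (fun _ : R => k) by move=> t; exact: cvg_cst.
pose psi t := (F (x - t) - F x) * g t.
have ipsi : mu.-integrable `[- pi, pi] (EFin \o psi).
  apply: BV_T_integrableM BVg => t.
  by apply: cvgB; [exact: continuous_comp_refl|exact: cvg_cst].
have -> : period_conv F g x - F x = \int[mu]_(t in `[- pi, pi]) psi t.
  rewrite -[X in _ - X]mulr1 -g1 -RintegralZl// -RintegralB//.
    by apply: eq_Rintegral => t _; rewrite /psi mulrBl.
  exact: BV_T_integrableM BVg.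
have ing : mu.-integrable `[- pi, pi] (EFin \o (fun t => `|g t|)).
  exact: (integrable_norm ig).
have inpsi : mu.-integrable `[- pi, pi] (EFin \o (fun t => `|psi t|)).
  exact: (integrable_norm ipsi).
apply: (le_trans (le_normr_Rintegral _ ipsi)) => //.
(* The tail set excludes the points of modulus [pi], so that the pointwise
   bound below can only hold on the open period. *)
rewrite -(Rintegral_itv_oo_cc inpsi) -(Rintegral_itv_oo_cc ing).
pose S := [set s : R | d < `|s|].
have mS : measurable S.
  have -> : S = ~` `[- d, d]%classic.
    apply/seteqP; split => s; rewrite /S /= in_itv/= -ler_norml ltNge.
      by move/negP.
    by move=> h; apply/negP.
  exact: measurableC.
have -> : [set s | d < `|s| < pi] = `]- pi, pi[ `&` S.
  apply/seteqP; split => s; rewrite /S /= in_itv/= -ltr_norml.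
    by move=> /andP[-> ->].
  by move=> [-> ->].
have sub : `]- pi, pi[ `<=` `[- pi, pi :> R] by exact: subset_itv_oo_cc.
have ingo : mu.-integrable `]- pi, pi[ (EFin \o (fun t => `|g t|)).
  by apply: integrableS ing.
rewrite Rintegral_mkcondr.
set gS := (fun t => `|g t|) \_ S.
have igS : mu.-integrable `]- pi, pi[ (EFin \o gS).
  rewrite /gS -restrict_EFin; apply/integrable_restrict => //.
  by apply: integrableS ingo => //; exact: measurableI.
have i1 : mu.-integrable `]- pi, pi[ (EFin \o (fun t => e * `|g t|)).
  by apply: (integrableZl _ e ingo).
have i2 : mu.-integrable `]- pi, pi[ (EFin \o (fun t => K * gS t)).
  by apply: (integrableZl _ K igS).
have i12 : mu.-integrable `]- pi, pi[ (EFin \o (fun t => e * `|g t| + K * gS t)).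
  by apply: integrableD i1 i2.
have inpsio : mu.-integrable `]- pi, pi[ (EFin \o (fun t => `|psi t|)).
  by apply: integrableS inpsi.
rewrite -RintegralZl// -RintegralZl// -RintegralD//.
apply: (le_Rintegral _ inpsio i12) => //.
move=> t /=; rewrite in_itv/= -ltr_norml => tpi.
rewrite /psi normrM /gS patchE; case: ifPn => [_|].
  rewrite -[leLHS]add0r lerD//; last by rewrite ler_wpM2r// FK// ltW.
  rewrite mulr_ge0//; apply: le_trans (Fe 0 _); rewrite ?normr_ge0//.
  by rewrite normr0 ltW.
rewrite notin_setE/= => /negP; rewrite -leNgt => td.
by rewrite mulr0 addr0 ler_wpM2r// Fe.
Qed.

End ApproximateIdentity.

Theorem theorem11 (R : realType) (f : test_fun R -> R) (k : nat -> R -> R)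
  (hf : A_c f) (hk : summability_kernel k) :
  (forall n, loc_integrable_T (convolution f (k n)) /\
             A_c (regular_distr (convolution f (k n)) - f)) /\
  alexiewicz_norm (regular_distr (convolution f (k n)) - f) @[n --> \oo]
    --> (0 : R).
Proof.
have [df [F fF]] := hf; have [BVk k1 klim [M kM]] := hk; have BF := fF.1.
have prim n := is_primitive_convolutionB df fF (BVk n) (k1 n).
split=> [n|].
  have cc := convolution_continuous fF (BVk n).
  split.
    by split; [exact: convolution_periodic fF (BVk n)|exact: continuous_locally_integrable].
  split; last by eexists; exact: prim n.
  by apply: distributionB => //; exact: distribution_regular.
have M0 : 0 <= M by rewrite (le_trans _ (kM 0%N))// Rintegral_ge0.
have [K K0 FK] := B_c_increment_bounded BF.
apply/cvgrPdist_le => e e0.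
(* The primitive of the difference moves by at most twice its distance to
   [F], and this distance has two parts; hence the quarters of [e]. *)
pose eta := e / (4 * (M + 1)).
have eta0 : 0 < eta by rewrite divr_gt0// mulr_gt0// ltr_wpDl.
have etaM : eta * M <= e / 4.
  rewrite /eta mulrAC ler_pdivrMr; last by rewrite mulr_gt0// ltr_wpDl.
  rewrite (_ : e / 4 * (4 * (M + 1)) = e * (M + 1)); last by field.
  by rewrite ler_pM2l// lerDl.
have [d d0 hd] := B_c_uniform BF eta0.
pose delta := Num.min (d / 2) pi.
have delta0 : 0 < delta by rewrite lt_min divr_gt0// pi_gt0.
have deltapi : delta <= pi by rewrite ge_min lexx orbT.
have deltad : delta < d by rewrite gt_min; apply/orP; left; lra.
have /cvgrPdist_le /(_ (e / (4 * K))) := klim delta delta0 deltapi.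
rewrite divr_gt0 ?mulr_gt0// => /(_ isT); apply: filterS => n.
rewrite sub0r normrN => tail.
have {}tail : K * \int[@lebesgue_measure R]_(s in [set s | delta < `|s| < pi]) `|k n s| <= e / 4.
  have := le_trans (ler_norm _) tail.
  rewrite ler_pdivlMr ?mulr_gt0//; lra.
have D x : `|period_conv F (k n) x - F x| <= e / 2.
  apply: (le_trans (period_conv_sub_le BF (BVk n) (k1 n) delta0 _ (FK x))) => [t td|].
    apply/ltW/hd; rewrite addrAC subrr add0r normrN; exact: le_lt_trans deltad.
  have := ler_wpM2l (ltW eta0) (kM n); lra.
rewrite sub0r normrN /alexiewicz_norm /cp_integral (primitiveE (prim n)).
set H := fun x => _.
set A := [set r | _].
have A0 : A 0.
  by exists 0, 0; rewrite lexx !subrr normr0; split => //; rewrite mulr_ge0// pi_ge0.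
have Ae : ubound A e.
  move=> _ [a [b [_ _ ->]]]; rewrite /H.
  by have := D a; have := D b; rewrite !ler_norml; lra.
rewrite ger0_norm; first by apply: ge_sup => //; exists 0.
by apply: ub_le_sup => //; exists e.
Qed.
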